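(* Let $\Delta$ be a finite simplicial complex with $\operatorname{depth}\Delta=d-1$, and let $r$ be an integer with $2\le r\le d/2$. Let $\mathcal{A},\mathcal{B}$ be nonempty cross-intersecting families consisting of $r$-element faces of $\Delta$. If $\Delta$ is shifted with respect to $\{v_1<\cdots<v_r\}$, then \[|\mathcal{A}|+|\mathcal{B}|\le f_r(\Delta)-\gamma+1,\] where $\gamma$ is the number of $r$-element faces of $\Delta$ containing no element of $\{v_1,\dots,v_r\}$.
   Context: A simplicial complex is a nonempty finite family of sets closed under subsets; $f_k(\Delta)$ is the number of $k$-element faces; $\operatorname{link}_\Delta A=\{B\in\Delta:A\cap B=\emptyset,A\cup B\in\Delta\}$. Fix a field $\mathbb{F}$. A complex $\Gamma$ is Cohen-Macaulay if $\tilde H_i(\operatorname{link}_\Gamma A;\mathbb{F})=0$ for all faces $A$ (including $\emptyset$) and all $i<\dim\operatorname{link}_\Gamma A$ (a face $A$ has dimension $|A|-1$). The depth of $\Delta$ is the largest $k$ such that the subcomplex of faces of dimension at most $k$ is Cohen-Macaulay. $\Delta$ is shifted with respect to $\{v_1<\cdots<v_t\}$ if for every $i\le t$, every face $B$, and every $w\in B$ with $w\notin\{v_1,\dots,v_i\}$ and $v_i\notin B$, the set $(B\setminus\{w\})\cup\{v_i\}$ is a face. Families $\mathcal{A},\mathcal{B}$ are cross-intersecting if $A\cap B\neq\emptyset$ for all $A\in\mathcal{A}$, $B\in\mathcal{B}$. *)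

(* Defs.v *)
From HB Require Import structures.
From mathcomp Require Import all_boot all_order all_algebra.
Set Implicit Arguments. Unset Strict Implicit. Unset Printing Implicit Defensive.
Import GRing.Theory.
Local Open Scope ring_scope.

Section SimplicialDefs.
Variable V : finType.

Definition simplicial_complex (D : {set {set V}}) : Prop :=
  D != set0 /\ forall A B : {set V}, A \in D -> B \subset A -> B \in D.

Definition faces (D : {set {set V}}) (k : nat) : {set {set V}} :=
  [set A in D | #|A| == k].
Definition fvec (D : {set {set V}}) (k : nat) : nat := #|faces D k|.

Definition link (D : {set {set V}}) (A : {set V}) : {set {set V}} :=
  [set B in D | [disjoint A & B] && (A :|: B \in D)].

(* maximal face size, i.e. dim D + 1 *)
Definition maxsize (D : {set {set V}}) : nat := (\max_(A in D) #|A|)%N.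

(* sets of at most k elements (the (k-1)-skeleton) *)
Definition skeleton (D : {set {set V}}) (k : nat) : {set {set V}} :=
  [set A in D | #|A| <= k]%N.

Variable F : fieldType.

(* Boundary matrix (row-vector convention) from faces with k elements to faces
   with k-1 elements, with the vertex order given by enum_rank; for k = 0 it is 0.
   For k = 1 it is the augmentation map (reduced complex). *)
Definition bd (D : {set {set V}}) (k : nat) :
    'M[F]_(#|faces D k|, #|faces D k.-1|) :=
  \matrix_(i < #|faces D k|, j < #|faces D k.-1|)
    let A : {set V} := enum_val (A := faces D k) i in
    let B : {set V} := enum_val (A := faces D k.-1) j in
    \sum_(x in A | B == A :\ x)
       (-1) ^+ #|[set w in A | (enum_rank w < enum_rank x)%N]|.

(* reduced homology in dimension k-1 vanishes:
   dim C_{k-1} - rank d_{k-1} - rank d_k = 0 *)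
Definition red_hom_vanishes (D : {set {set V}}) (k : nat) : Prop :=
  #|faces D k| = (\rank (bd D k) + \rank (bd D k.+1))%N.

(* Cohen-Macaulay over F: for every face A and every i < dim link A,
   H~_i(link A; F) = 0.  With k = i+1 (i >= -1) and dim = maxsize - 1. *)
Definition cohen_macaulay (D : {set {set V}}) : Prop :=
  forall A, A \in D -> forall k : nat, (k < maxsize (link D A))%N ->
    red_hom_vanishes (link D A) k.

(* depth D = d - 1: the skeleton of faces of dimension <= d-1 (size <= d)
   is CM, and it is the largest such (among dimensions up to dim D). *)
Definition depth_is (D : {set {set V}}) (d : nat) : Prop :=
  [/\ cohen_macaulay (skeleton D d), (d <= maxsize D)%N &
      forall k, (d < k <= maxsize D)%N -> ~ cohen_macaulay (skeleton D k)].

End SimplicialDefs.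

Definition shifted_wrt (V : finType) (t : nat) (D : {set {set V}}) (v : t.-tuple V) : Prop :=
  forall (i : 'I_t) (B : {set V}) (w : V),
    B \in D -> w \in B ->
    w \notin [set tnth v j | j : 'I_t & (j <= i)%N] ->
    tnth v i \notin B ->
    (B :\ w) :|: [set tnth v i] \in D.

Definition cross_intersecting (V : finType) (A B : {set {set V}}) : Prop :=
  forall X Y, X \in A -> Y \in B -> X :&: Y != set0.

(* Main.v *)
(** Over an algebraically closed field K, a functional th on K^V acts on the exterior
    algebra of K^V by contraction. A subspace X splits into X^0, the kernel of the
    contraction on X, and X^1, its image, with dim X = dim X^0 + dim X^1. The two
    families span coordinate subspaces L and M with L /\ M = 0, and this is inherited
    by (L^1, M^0), (L^0, M^1) and (L^0, M^0). Along a generic sequence of directions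
    one has X^{01} <= X^{10}, the linear counterpart of shiftedness, so the
    lattice-path argument for cross-intersecting shifted families can be run on
    dimensions: the dimensions of the parts of the chain spaces of the complex play
    the role of the numbers of faces.

    The first r directions are the coordinate functionals of v_1, ..., v_r, where
    compression of the two families replaces genericity; after compression both
    families contain {v_1, ..., v_r}, which produces the term gamma. The remaining
    directions are generic on the deletion of v_1, ..., v_r.

    The Cohen-Macaulay hypothesis enters as exactness: each deletion costs one unit of
    depth, so the boundary weighted by th is exact in sizes below d minus the number
    of zeros of th. Exactness along a flag of directions follows from exactness for
    all nonzero combinations, by an eigenvalue argument. Since the homology only
    depends on the characteristic, the ground field may be replaced by the algebraic
    closure of its prime field. *)
Require Import Defs.
From HB Require Import structures.
From mathcomp Require Import all_boot all_order all_algebra all_field.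
From mathcomp Require Import ring zify.
From Stdlib Require Classical_Prop.
Set Implicit Arguments. Unset Strict Implicit. Unset Printing Implicit Defensive.
Import GRing.Theory.

(** * Weighted boundaries on the exterior algebra *)

Section Exterior.
Local Open Scope ring_scope.
Variables (V : finType) (K : fieldType).
Notation E := {ffun {set V} -> K^o}.
Notation W := {ffun V -> K^o}.

Definition before (x : V) (X : {set V}) : nat :=
  #|[set w in X | (enum_rank w < enum_rank x)%N]|.

Lemma beforeU1 x y (X : {set V}) : y \notin X ->
  before x (y |: X) = ((enum_rank y < enum_rank x) + before x X)%N.
Proof.
move=> yX; rewrite /before.
have -> : [set w in y |: X | (enum_rank w < enum_rank x)%N] =
  (if (enum_rank y < enum_rank x)%N then [set y] else set0)
    :|: [set w in X | (enum_rank w < enum_rank x)%N].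
  apply/setP=> w; rewrite !inE; case: eqVneq => [->|nwy] /=.
    by case: ifP => h; rewrite !inE ?eqxx ?h ?(negbTE yX) ?andbF.
  by case: ifP => h; rewrite !inE ?(negbTE nwy).
case: ifP => h; last by rewrite set0U.
by rewrite cardsU1 !inE (negbTE yX).
Qed.

Lemma before_self x (X : {set V}) : before x (x |: X) = before x X.
Proof.
case: (boolP (x \in X)) => xX; first by rewrite (setUidPr _) // sub1set.
by rewrite beforeU1 // ltnn.
Qed.

Lemma before_D1 x (X : {set V}) : before x (X :\ x) = before x X.
Proof.
case: (boolP (x \in X)) => xX; last by rewrite (setDidPl _) // disjoint_sym disjoints1.
by rewrite -{2}(setD1K xX) before_self.
Qed.

Definition sgn x (X : {set V}) : K := (-1) ^+ before x X.

Lemma sgnK x (X : {set V}) : sgn x X * sgn x X = 1.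
Proof. by rewrite /sgn -expr2 sqrr_sign. Qed.

(** The earlier of [x] and [y] is counted in the position of the later one and not conversely, so
    exactly one of the two signs changes. *)
Lemma sgn_anti x y (X : {set V}) : x != y -> x \notin X -> y \notin X ->
  sgn x X * sgn y (x |: X) = - (sgn y X * sgn x (y |: X)).
Proof.
move=> nxy xX yX; rewrite /sgn !beforeU1 // !exprD.
have : (enum_rank x != enum_rank y) by rewrite (inj_eq enum_rank_inj).
rewrite -(inj_eq val_inj) /= neq_ltn; case/orP=> h; rewrite h.
  by rewrite ltnNge ltnW //= expr0 expr1; ring.
by rewrite [X in (-1) ^+ nat_of_bool X]ltnNge ltnW //= expr0 expr1; ring.
Qed.

Definition contrf (th : W) (f : E) : E :=
  [ffun X : {set V} => \sum_(x | x \notin X) th x * (sgn x X * f (x |: X))].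

Lemma contrf_linear th : linear (contrf th).
Proof.
move=> a f g; apply/ffunP=> X; rewrite !ffunE scaler_sumr -big_split /=.
apply: eq_bigr => x xX; rewrite !ffunE /GRing.scale /=; ring.
Qed.
HB.instance Definition _ th := GRing.isLinear.Build K E E *:%R (contrf th) (contrf_linear th).

Definition contr th : 'End(E) := linfun (contrf th).

Lemma contrE th f (X : {set V}) : contr th f X = \sum_(x | x \notin X) th x * (sgn x X * f (x |: X)).
Proof. by rewrite lfunE /= ffunE. Qed.

Lemma contrD th eta : contr (th + eta) = contr th + contr eta.
Proof.
apply/lfunP=> f; apply/ffunP=> X; rewrite add_lfunE [RHS]ffunE !contrE -big_split /=.
by apply: eq_bigr => x _; rewrite ffunE mulrDl.
Qed.

Lemma contrZ a th : contr (a *: th) = a *: contr th.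
Proof.
apply/lfunP=> f; apply/ffunP=> X; rewrite scale_lfunE [RHS]ffunE !contrE scaler_sumr.
by apply: eq_bigr => x _; rewrite ffunE /GRing.scale /= -mulrA.
Qed.

(* The terms are paired off, so that characteristic 2 is allowed. *)
Lemma sum_antisym (c : rel V) (F : V -> V -> K) :
    symmetric c -> (forall x, ~~ c x x) ->
    (forall x y, c x y -> F x y = - F y x) ->
  \sum_x \sum_(y | c x y) F x y = 0.
Proof.
move=> csym cirr Fanti.
pose lt (x y : V) := (enum_rank x < enum_rank y)%N.
transitivity (\sum_x \sum_(y | c x y && lt x y) F x y + \sum_x \sum_(y | c x y && lt y x) F x y).
  rewrite -big_split /=; apply: eq_bigr => x _.
  rewrite (bigID (lt x)) /=; congr (_ + _); apply: eq_bigl => y.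
  case: (boolP (c x y)) => //= cxy; rewrite /lt -leqNgt leq_eqVlt.
  case: eqP => //= /val_inj/enum_rank_inj eyx.
  by move: (cirr x); rewrite -{2}eyx cxy.
have -> : \sum_x \sum_(y | c x y && lt y x) F x y = \sum_x \sum_(y | c x y && lt x y) F y x.
  rewrite (exchange_big_dep predT) //=; apply: eq_bigr => x _.
  by apply: eq_bigl => y; rewrite csym.
rewrite -big_split big1 //= => x _.
by rewrite -big_split big1 //= => y /andP[cxy _]; rewrite Fanti // addNr.
Qed.

Lemma contr_sq th f : contr th (contr th f) = 0.
Proof.
apply/ffunP=> X; rewrite contrE [RHS]ffunE.
pose F x y := th x * (sgn x X * (th y * (sgn y (x |: X) * f (y |: (x |: X))))).
pose c x y := [&& x \notin X, y \notin X & x != y].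
rewrite -[RHS](@sum_antisym c F).
- rewrite big_mkcond /=; apply: eq_bigr => x _.
  case: ifP => xX; last by rewrite big1 // => y; rewrite /c xX.
  rewrite contrE !mulr_sumr; apply: eq_bigl => y.
  by rewrite /c xX in_setU1 negb_or andbC eq_sym.
- by move=> x y; rewrite /c eq_sym; case: (x \in X); case: (y \in X).
- by move=> x; rewrite /c eqxx !andbF.
- move=> x y /and3P[xX yX nxy]; rewrite /F setUCA.
  have := sgn_anti nxy xX yX; move: (f _) => fxy h.
  transitivity (th x * th y * fxy * (sgn x X * sgn y (x |: X))); first by ring.
  by rewrite h; ring.
Qed.

(** Polarization of [contr_sq] at [th + eta]. *)
Lemma contr_anti th eta f : contr th (contr eta f) = - contr eta (contr th f).
Proof.
apply/eqP; rewrite -addr_eq0; apply/eqP.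
have := contr_sq (th + eta) f.
rewrite contrD !add_lfunE !linearD /= !contr_sq addr0 add0r.
by rewrite addrC.
Qed.

(** Left exterior multiplication by the basis vector of [x]. *)
Definition creation (x : V) (f : E) : E :=
  [ffun X : {set V} => if x \in X then sgn x X * f (X :\ x) else 0].

Lemma creation_linear x : linear (creation x).
Proof.
move=> a f g; apply/ffunP=> X; rewrite !ffunE; case: ifP => _.
  by rewrite /GRing.scale /=; ring.
by rewrite scaler0 addr0.
Qed.
HB.instance Definition _ x := GRing.isLinear.Build K E E *:%R (creation x) (creation_linear x).

Lemma sgn_D1 x (X : {set V}) : sgn x (X :\ x) = sgn x X.
Proof. by rewrite /sgn before_D1. Qed.

Lemma sgn_U1 x (X : {set V}) : sgn x (x |: X) = sgn x X.
Proof. by rewrite /sgn before_self. Qed.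

(** The canonical anticommutation relation. At a set without [x] only the term of [x] survives; at a
    set containing [x] the term of [x] in the inner contraction cancels [th x *: f], and the others
    match by [sgn_anti]. *)
Lemma contr_creation th x f : contr th (creation x f) = th x *: f - creation x (contr th f).
Proof.
apply/ffunP=> X; rewrite contrE !ffunE; case: (boolP (x \in X)) => xX; last first.
  rewrite subr0 (bigD1 x) //= big1 ?addr0 => [|y /andP[yX nyx]].
    by rewrite ffunE setU11 sgn_U1 setU1K // [sgn x X * _]mulrA sgnK mul1r.
  by rewrite ffunE in_setU1 eq_sym (negbTE nyx) (negbTE xX) !mulr0.
rewrite contrE [\sum_(i | i \notin X :\ x) _](bigD1 x) /=; last by rewrite !inE eqxx.
rewrite sgn_D1 setD1K //.
have -> : th x *: f X - sgn x X * (th x * (sgn x X * f X) +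
     \sum_(i | (i \notin X :\ x) && (i != x)) th i * (sgn i (X :\ x) * f (i |: X :\ x)))
  = - \sum_(i | (i \notin X :\ x) && (i != x)) sgn x X * (th i * (sgn i (X :\ x) * f (i |: X :\ x))).
  rewrite -mulr_sumr; set S := bigop.body _ _ _; rewrite /GRing.scale /=.
  transitivity (th x * f X - (sgn x X * sgn x X) * (th x * f X) - sgn x X * S); first by ring.
  by rewrite sgnK; ring.
rewrite -sumrN; apply: eq_big => [y|y yX].
  by rewrite !inE; case: (y =P x) => [->|]; rewrite ?xX ?andbT.
have nyx : y != x by apply: contraNneq yX => ->.
rewrite ffunE in_setU1 xX orbT.
have -> : (y |: X) :\ x = y |: X :\ x.
  by apply/setP=> z; rewrite !inE; case: (z =P y) => [->|]; rewrite ?nyx.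
have xXx : x \notin X :\ x by rewrite !inE eqxx.
have yXx : y \notin X :\ x by rewrite !inE (negbTE yX) andbF.
have := sgn_anti nyx yXx xXx; rewrite setD1K // sgn_D1.
have -> : sgn x (y |: X :\ x) = sgn x (y |: X).
  rewrite -(sgn_D1 x (y |: X)); congr (sgn x _).
  by apply/setP=> z; rewrite !inE; case: (z =P y) => [->|]; rewrite ?nyx.
move: (f _) => fxy h.
have h' : sgn y X * sgn x (y |: X) = - (sgn x X * sgn y (X :\ x)).
  transitivity (sgn y X * sgn y (X :\ x) * (sgn y (X :\ x) * sgn x (y |: X))).
    by rewrite mulrA -(mulrA (sgn y X)) sgnK mulr1.
  rewrite h; transitivity (- (sgn y X * sgn y X) * (sgn x X * sgn y (X :\ x))); first by ring.
  by rewrite sgnK mulN1r.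
transitivity (th y * fxy * (sgn y X * sgn x (y |: X))); first by ring.
by rewrite h'; ring.
Qed.

End Exterior.

(** * Wedge product *)

Section Wedge.
Local Open Scope ring_scope.
Variables (V : finType) (K : fieldType).
Notation E := {ffun {set V} -> K^o}.
Notation W := {ffun V -> K^o}.

Definition inversions (Y Z : {set V}) : nat := \sum_(y in Y) before y Z.

Definition wedge (l m : E) : E :=
  [ffun X : {set V} => \sum_(Y : {set V} | Y \subset X)
     (-1) ^+ inversions Y (X :\: Y) * (l Y * m (X :\: Y))].

Definition gradesign (l : E) : E := [ffun X : {set V} => (-1) ^+ #|X| * l X].

Lemma sum_subsetU1 (x : V) (X : {set V}) (F : {set V} -> K) : x \notin X ->
  \sum_(Y : {set V} | Y \subset x |: X) F Y = \sum_(Y : {set V} | Y \subset X) (F Y + F (x |: Y)).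
Proof.
move=> xX; rewrite (bigID (fun Y : {set V} => x \in Y)) /= addrC big_split /=; congr (_ + _).
  apply: eq_bigl => Y; apply/andP/idP=> [[/subsetP YX xY]|/subsetP YX]; last first.
    split; first by apply/subsetP=> y /YX yX; rewrite in_setU1 yX orbT.
    by apply: contra xX => /YX.
  apply/subsetP=> y yY; have := YX y yY; rewrite in_setU1 => /predU1P[eyx|//].
  by rewrite -eyx yY in xY.
rewrite (reindex_onto (fun Y => x |: Y) (fun Y => Y :\ x)) /=; last first.
  by move=> Y /andP[_ xY]; rewrite setD1K.
apply: eq_bigl => Y; rewrite setU11 andbT; apply/andP/idP=> [[/subsetP YX /eqP exY]|/subsetP YX].
  apply/subsetP=> y yY; have : y \in x |: Y by rewrite in_setU1 yY orbT.
  move/YX; rewrite in_setU1 => /predU1P[eyx|//].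
  by move: yY; rewrite eyx -exY !inE eqxx.
split; first by rewrite setUS //; apply/subsetP.
by apply/eqP; rewrite setU1K //; apply: contra xX => /YX.
Qed.

Lemma inversionsU1l x (Y Z : {set V}) : x \notin Y ->
  inversions (x |: Y) Z = (before x Z + inversions Y Z)%N.
Proof. by move=> xY; rewrite /inversions big_setU1. Qed.

(** Each element of [Y] lies either after [x], giving a new inversion, or before it. *)
Lemma inversionsU1r x (Y Z : {set V}) : x \notin Y -> x \notin Z ->
  (inversions Y (x |: Z) + before x Y = #|Y| + inversions Y Z)%N.
Proof.
move=> xY xZ; rewrite /inversions.
rewrite (eq_bigr (fun y => (enum_rank x < enum_rank y) + before y Z))%N; last first.
  by move=> y yY; rewrite beforeU1.
rewrite big_split /= addnAC; congr (_ + _)%N.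
have -> : before x Y = (\sum_(y in Y) (enum_rank y < enum_rank x))%N.
  rewrite /before -sum1_card big_mkcond [RHS]big_mkcond /=; apply: eq_bigr => y _.
  by rewrite inE; case: (y \in Y) => //=; case: (_ < _)%N.
rewrite -big_split -[#|Y|]sum1_card /=; apply: eq_bigr => y yY.
have : enum_rank x != enum_rank y by rewrite (inj_eq enum_rank_inj); apply: contraNneq xY => ->.
rewrite -(inj_eq val_inj) /= neq_ltn => /orP[] h; rewrite h ltnNge ltnW //.
Qed.

Lemma sign_parity (m n : nat) : odd m = odd n -> (-1) ^+ m = (-1) ^+ n :> K.
Proof. by move=> e; rewrite -signr_odd e signr_odd. Qed.

(** The graded Leibniz rule. The terms with [x] outside [X] agree on both sides; the right side has
    further terms with [x] in [X], which cancel in pairs. *)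
Lemma contr_wedge th l m : contr th (wedge l m) =
  wedge (contr th l) m + wedge (gradesign l) (contr th m).
Proof.
apply/ffunP=> X; rewrite contrE [RHS]ffunE [in RHS]/wedge !ffunE.
pose T1 x (Y : {set V}) := th x * ((-1) ^+ inversions Y (X :\: Y) * sgn K x Y) * (l (x |: Y) * m (X :\: Y)).
pose T2 x (Y : {set V}) := th x * ((-1) ^+ (inversions Y (X :\: Y) + #|Y|) * sgn K x (X :\: Y)) * (l Y * m (x |: (X :\: Y))).
transitivity (\sum_(x | x \notin X) \sum_(Y : {set V} | Y \subset X) (T1 x Y + T2 x Y)).
  apply: eq_bigr => x xX; rewrite ffunE sum_subsetU1 // !mulr_sumr.
  apply: eq_bigr => Y YX; rewrite addrC mulrDr mulrDr.
  have xY : x \notin Y by apply: contra xX; apply: (subsetP YX).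
  have xXY : x \notin X :\: Y by rewrite !inE (negbTE xX) andbF.
  have -> : (x |: X) :\: (x |: Y) = X :\: Y.
    apply/setP=> z; rewrite !inE negb_or; case: (z =P x) => [->|] //=; first by rewrite (negbTE xX) andbF.
  have -> : (x |: X) :\: Y = x |: (X :\: Y).
    apply/setP=> z; rewrite !inE; case: (z =P x) => [->|] //=; by rewrite xY.
  have bX : before x X = (before x Y + before x (X :\: Y))%N.
    rewrite /before.
    have -> : [set w in X | (enum_rank w < enum_rank x)%N] =
        [set w in Y | (enum_rank w < enum_rank x)%N] :|: [set w in X :\: Y | (enum_rank w < enum_rank x)%N].
      apply/setP=> z; rewrite !inE; case: (boolP (z \in Y)) => [/(subsetP YX) ->|_] /=.
        by rewrite orbF.
      by [].
    rewrite cardsU.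
    have -> : [set w in Y | (enum_rank w < enum_rank x)%N] :&: [set w in X :\: Y | (enum_rank w < enum_rank x)%N] = set0.
      by apply/setP=> z; rewrite !inE; case: (z \in Y); rewrite ?andbF.
    by rewrite cards0 subn0.
  congr (_ + _).
    rewrite /T1 /sgn !mulrA; congr (_ * _ * _); rewrite -!mulrA; congr (_ * _).
    rewrite inversionsU1l // -!exprD; apply: sign_parity; rewrite bX !oddD; lia.
  rewrite /T2 /sgn !mulrA; congr (_ * _ * _); rewrite -!mulrA; congr (_ * _).
  rewrite -!exprD; apply: sign_parity.
  have := inversionsU1r xY xXY; rewrite bX; lia.
transitivity (\sum_(Y : {set V} | Y \subset X) ((\sum_(x | x \notin Y) T1 x Y) + \sum_(x | x \notin X :\: Y) T2 x Y)); last first.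
  rewrite big_split /=; congr (_ + _); apply: eq_bigr => Y YX.
    rewrite contrE mulr_suml mulr_sumr; apply: eq_bigr => x xY.
    by rewrite /T1; ring.
  rewrite contrE ffunE !mulr_sumr; apply: eq_bigr => x xY.
  by rewrite /T2 exprD; ring.
rewrite exchange_big /=; apply/eqP; rewrite -subr_eq0 -sumrB; apply/eqP.
transitivity (- \sum_(Y : {set V} | Y \subset X) (\sum_(x in X) ((if x \notin Y then T1 x Y else 0) + (if x \in Y then T2 x Y else 0)))).
  rewrite -sumrN; apply: eq_bigr => Y YX; rewrite big_split /= opprD.
  rewrite !big_split /= opprD addrACA; congr (_ + _).
    rewrite (bigID (fun x => x \in X) (fun x => x \notin Y)) /= opprD addrCA.
    rewrite [X in - _ + X](_ : _ = 0); last first.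
      apply/eqP; rewrite subr_eq0; apply/eqP; apply: eq_bigl => x.
      by case: (boolP (x \in X)) => xX; rewrite ?andbF ?andbT //; apply/esym/negP=> /(subsetP YX); rewrite (negbTE xX).
    by rewrite addr0 -big_mkcondr; congr (- _); apply: eq_bigl => x; rewrite andbC.
  rewrite (bigID (fun x => x \in X) (fun x => x \notin X :\: Y)) /= opprD addrCA.
  rewrite [X in - _ + X](_ : _ = 0); last first.
    apply/eqP; rewrite subr_eq0; apply/eqP; apply: eq_bigl => x.
    by rewrite !inE; case: (x \in X); rewrite ?andbF.
  rewrite addr0 -big_mkcondr; congr (- _); apply: eq_bigl => x.
  by rewrite !inE; case: (x \in X); case: (x \in Y).
apply/eqP; rewrite oppr_eq0; apply/eqP; rewrite exchange_big /= big1 // => x xX.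
(* A set [Y] avoiding [x] contributes [T1 x Y], its partner [x |: Y] contributes [T2 x (x |: Y)],
   and these are opposite. *)
rewrite -{1}(setD1K xX) sum_subsetU1; last by rewrite !inE eqxx.
apply: big1 => Y YX.
have xY : x \notin Y by apply: contraL isT => /(subsetP YX); rewrite !inE eqxx.
rewrite xY (negbTE xY) setU11 /= addr0 add0r.
have xXY : x \notin X :\: (x |: Y) by rewrite !inE eqxx.
have eXY : X :\: Y = x |: (X :\: (x |: Y)).
  by apply/setP=> z; rewrite !inE; case: (z =P x) => [->|]; rewrite ?xX ?xY.
rewrite /T1 /T2 -eXY.
have -> : sgn K x (X :\: (x |: Y)) = sgn K x (X :\: Y) by rewrite eXY sgn_U1.
rewrite -mulrDl -mulrDr; apply/eqP; rewrite mulf_eq0 mulf_eq0; apply/orP; left; apply/orP; right.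
rewrite /sgn -!exprD addr_eq0 -[X in _ == X]mulN1r -exprS; apply/eqP; apply: sign_parity.
rewrite cardsU1 xY inversionsU1l //.
have bb : before x (X :\: (x |: Y)) = before x (X :\: Y) by rewrite [in RHS]eXY before_self.
rewrite bb.
have := inversionsU1r xY xXY; rewrite -eXY; lia.
Qed.

Lemma wedgel0 l : wedge l 0 = 0.
Proof. by apply/ffunP=> X; rewrite !ffunE big1 // => Y _; rewrite ffunE !mulr0. Qed.

Lemma wedge0l m : wedge 0 m = 0.
Proof. by apply/ffunP=> X; rewrite !ffunE big1 // => Y _; rewrite ffunE mul0r mulr0. Qed.

End Wedge.

(** * Parts of a subspace along a sequence of directions *)

Section Coordinate.
Local Open Scope ring_scope.
Variables (V : finType) (K : fieldType).
Notation E := {ffun {set V} -> K^o}.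
Notation W := {ffun V -> K^o}.
Implicit Types (X Y : {set V}) (FF GG : {set {set V}}) (f : E) (th : W).

Definition monom X : E := [ffun Y : {set V} => (Y == X)%:R].

Definition coordspace FF : {vspace E} := <<[seq monom X | X <- enum FF]>>%VS.

Lemma monom_sum f : f = \sum_X f X *: monom X.
Proof.
apply/ffunP=> Y; rewrite sum_ffunE (bigD1 Y) //= big1 => [|X nXY].
  by rewrite !ffunE eqxx addr0 /GRing.scale /= mulr1.
by rewrite !ffunE eq_sym (negbTE nXY) scaler0.
Qed.

Lemma memv_monom FF X : X \in FF -> monom X \in coordspace FF.
Proof. by move=> XF; apply/memv_span/map_f; rewrite mem_enum. Qed.

Lemma coordspaceP FF f : (f \in coordspace FF) <-> (forall X, X \notin FF -> f X = 0).
Proof.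
split=> [fF X XF|f0]; last first.
  rewrite (monom_sum f); apply: memv_suml => X _.
  have [XF|XF] := boolP (X \in FF); first exact: memvZ (memv_monom XF).
  by rewrite f0 // scale0r mem0v.
move: fF; rewrite /coordspace; set s := map _ _ => fs.
rewrite (coord_span (X := in_tuple s) fs) sum_ffunE big1 // => i _.
have /mapP[Y YF ->] : (in_tuple s)`_i \in s by rewrite mem_nth.
rewrite !ffunE; rewrite mem_enum in YF.
by case: eqP => [eXY|_]; [rewrite eXY YF in XF | rewrite scaler0].
Qed.

Lemma dim_coordspace FF : \dim (coordspace FF) = #|FF|.
Proof.
rewrite /coordspace cardE -(size_map monom); apply/eqP; rewrite -/(free _).
apply/(freeP (X := in_tuple _)) => k k0 i.
have sz : size [seq monom X | X <- enum FF] = size (enum FF) by rewrite size_map.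
have := congr1 (fun f : E => f (nth set0 (enum FF) i)) k0.
rewrite sum_ffunE ffunE (bigD1 i) //= big1 ?addr0.
  rewrite (nth_map set0) -?sz // !ffunE eqxx /GRing.scale /= mulr1; exact.
move=> j nij; rewrite (nth_map set0) -?sz // !ffunE nth_uniq ?enum_uniq -?sz //.
by rewrite eq_sym -val_eqE in nij; rewrite (negbTE nij) scaler0.
Qed.

Lemma coordspaceS FF GG : FF \subset GG -> (coordspace FF <= coordspace GG)%VS.
Proof.
move=> /subsetP sFG; apply/subvP=> f /coordspaceP fF; apply/coordspaceP=> X XG.
by apply: fF; apply: contra XG; apply: sFG.
Qed.

Lemma coordspace0 : coordspace set0 = 0%VS.
Proof. by apply/eqP; rewrite -dimv_eq0 dim_coordspace cards0. Qed.

Definition degspace k := coordspace [set X : {set V} | #|X| == k].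

Lemma degspaceP k f : (f \in degspace k) <-> (forall X, #|X| != k -> f X = 0).
Proof. by rewrite /degspace coordspaceP; split=> h X; have := h X; rewrite inE. Qed.

Lemma contr_degspace th k f : f \in degspace k.+1 -> contr th f \in degspace k.
Proof.
move/degspaceP=> f0; apply/degspaceP=> X nX; rewrite contrE big1 // => x xX.
by rewrite f0 ?mulr0 // cardsU1 xX.
Qed.

Lemma contr_degspace0 th f : f \in degspace 0 -> contr th f = 0.
Proof.
move/degspaceP=> f0; apply/ffunP=> X; rewrite contrE ffunE big1 // => x xX.
by rewrite f0 ?mulr0 // cardsU1 xX.
Qed.

Lemma degspace0P f : f \in degspace 0 -> f = f set0 *: monom set0.
Proof.
move/degspaceP=> f0; apply/ffunP=> X; rewrite !ffunE.
case: eqP => [->|/eqP nX]; first by rewrite /GRing.scale /= mulr1.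
by rewrite (f0 X) ?cards_eq0 // scaler0.
Qed.

Lemma dim_degspace0 (L : {vspace E}) : (L <= degspace 0%N)%VS -> (\dim L <= 1)%N.
Proof.
move/dimvS; rewrite dim_coordspace => /leq_trans; apply.
rewrite (_ : [set X | _] = [set set0]) ?cards1 //.
by apply/setP=> X; rewrite !inE cards_eq0.
Qed.

Definition dirac (x : V) : W := [ffun y => (y == x)%:R].

Lemma contr_dirac x f X : contr (dirac x) f X = if x \in X then 0 else sgn K x X * f (x |: X).
Proof.
rewrite contrE; case: ifP => xX.
  rewrite big1 // => y yX; rewrite ffunE.
  by case: eqP => [eyx|_]; [rewrite eyx xX in yX | rewrite mul0r].
rewrite (bigD1 x) ?xX //= big1 => [|y /andP[_ nyx]].
  by rewrite ffunE eqxx mul1r addr0.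
by rewrite ffunE (negbTE nyx) mul0r.
Qed.

(** The coordinate functional of a point of [X] recovers the coefficient at [X] up to sign; positive
    degree provides such a point. *)
Lemma degspace_contr_eq0 f k : f \in degspace k.+1 -> (forall th, contr th f = 0) -> f = 0.
Proof.
move/degspaceP=> f0 c0; apply/ffunP=> X; rewrite [RHS]ffunE.
have [cX|] := eqVneq #|X| k.+1; last exact: f0.
have /card_gt0P[x xX] : (0 < #|X|)%N by rewrite cX.
have := congr1 (fun g : E => g (X :\ x)) (c0 (dirac x)).
rewrite contr_dirac !inE eqxx /= setD1K // ffunE => /eqP.
by rewrite mulf_eq0 signr_eq0 /= => /eqP.
Qed.

End Coordinate.

(** * Kernel and image patterns, linear shiftedness and exactness along a sequence *)

Section Recursion.
Local Open Scope ring_scope.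
Variables (V : finType) (K : fieldType).
Notation E := {ffun {set V} -> K^o}.
Notation W := {ffun V -> K^o}.
Implicit Types (L M X Y : {vspace E}) (f l m : E) (th : W) (ths : seq W) (p q : bitseq)
  (Z : nat -> {vspace E}).

Definition kerpart th X := (X :&: lker (contr th))%VS.
Definition impart th X := (contr th @: X)%VS.

(* The bit b_i selects the image (1) or the kernel (0) of the i-th contraction. *)
Fixpoint res p ths X := match p, ths with
  | b :: p', th :: ths' => res p' ths' (if b then impart th X else kerpart th X)
  | _, _ => X end.

(* The inclusion is the linear form of shiftedness: it holds when th maximizes the
   rank of contr th on X. *)
Fixpoint good ths X : Prop := if ths is th :: ths' then
  [/\ forall eta, (contr eta @: kerpart th X <= impart th X)%VS,
      good ths' (kerpart th X) & good ths' (impart th X)] else True.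

(** On the chain spaces of a complex, a coordinate functional gives the chain spaces of the deletion
    of its vertex. *)
Definition cut th Z k := kerpart th (Z k).

(** The range shrinks by one at each step because each cut costs one unit of depth. *)
Fixpoint exact_along d ths Z : Prop := if ths is th :: ths' then
  (forall j, (j < d)%N -> (kerpart th (Z j) <= impart th (Z j.+1))%VS) /\ exact_along d.-1 ths' (cut th Z)
  else True.

Definition graded Z := [/\ forall k, (Z k <= degspace V K k)%VS,
  forall th k, (contr th @: Z k.+1 <= Z k)%VS & monom K set0 \in Z 0].

(** Both orders of the product are included, so that the relation is symmetric by definition. *)
Definition perp L M := forall l m, l \in L -> m \in M -> wedge l m = 0 /\ wedge m l = 0.

Lemma dim_parts th X : \dim X = (\dim (impart th X) + \dim (kerpart th X))%N.
Proof. by rewrite addnC limg_ker_dim. Qed.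

Lemma kerpartS th X Y : (X <= Y)%VS -> (kerpart th X <= kerpart th Y)%VS.
Proof. by move=> sXY; apply: capvS. Qed.

Lemma impartS th X Y : (X <= Y)%VS -> (impart th X <= impart th Y)%VS.
Proof. exact: limgS. Qed.

Lemma resS p ths X Y : (X <= Y)%VS -> (res p ths X <= res p ths Y)%VS.
Proof.
elim: p ths X Y => [|b p IH] [|th ths] X Y sXY //=.
by apply: IH; case: b; [apply: impartS|apply: kerpartS].
Qed.

(** The inclusion in [good] puts the left side into the image of [t1], and the contraction by [t2]
    squares to zero. *)
Lemma good_swap t1 t2 ths X : good (t1 :: t2 :: ths) X ->
  (impart t2 (kerpart t1 X) <= kerpart t2 (impart t1 X))%VS.
Proof.
case=> sw _ _; apply/subvP=> f ff; rewrite memv_cap (subvP (sw t2)) //=.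
by have /memv_imgP[g _ ->] := ff; rewrite memv_ker contr_sq.
Qed.

Lemma res_swap k q ths X : (k.+1 < size ths)%N -> good ths X ->
  (res (false :: nseq k.+1 true ++ q) ths X <= res (nseq k true ++ [:: false, true & q]) ths X)%VS.
Proof.
elim: k ths X => [|k IH] [|t1 [|t2 ths]] X //= sz gX.
apply: subv_trans (IH (t2 :: ths) (impart t1 X) sz _); last by case: gX.
exact: (@resS (nseq k.+1 true ++ q) ths _ _ (good_swap gX)).
Qed.

Definition alt a b : bitseq := flatten (nseq a [:: b; ~~ b]).

Lemma res_alt a ths X : (2 * a <= size ths)%N -> good ths X ->
  (res (alt a false) ths X <= res (alt a true) ths X)%VS.
Proof.
elim: a ths X => [|a IH] [|t1 [|t2 ths]] X sz gX //=; try by move: sz => /=; lia.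
apply: subv_trans (resS _ _ (good_swap gX)) _.
by apply: IH; [move: sz => /=; lia | case: gX => _ _ [_ + _]].
Qed.

(** If the image part vanishes, the inclusion in [good] shows that every contraction kills [X], and
    a space of positive degree killed by all contractions is zero. *)
Lemma res_nseq_true k ths X : (X <= degspace V K k)%VS -> (k <= size ths)%N -> good ths X ->
  res (nseq k true) ths X = 0%VS -> X = 0%VS.
Proof.
elim: k ths X => [|k IH] [|th ths] X //= Xk sz [sw gk gi] r0.
have imX0 : impart th X = 0%VS.
  apply: IH r0 => //; apply/subvP=> _ /memv_imgP[g gX ->].
  by apply: contr_degspace; apply: subvP gX.
have kX : kerpart th X = X by apply/capv_idPl; rewrite lkerE -/(impart _ _) imX0.
apply/eqP; rewrite -subv0; apply/subvP=> f fX.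
rewrite memv0; apply/eqP/(degspace_contr_eq0 (k := k)); first exact: (subvP Xk).
move=> eta; apply/eqP; rewrite -memv0 -imX0; apply: (subvP (sw eta)).
by rewrite kX memv_img.
Qed.

Lemma res_degspace p ths X k : (X <= degspace V K k)%VS -> (size p <= size ths)%N ->
  (count id p <= k)%N -> (res p ths X <= degspace V K (k - count id p)%N)%VS.
Proof.
elim: p ths X k => [|b p IH] [|th ths] X k //=; rewrite ?subn0 // => Xk sz cp.
case: b cp => /= cp; last by apply: IH => //; apply: subv_trans Xk; apply: capvSl.
case: k Xk cp => // k Xk cp; rewrite add1n subSS; apply: IH => //.
by apply/subvP=> _ /memv_imgP[g gX ->]; apply: contr_degspace; apply: subvP gX.
Qed.

Lemma perp_sym L M : perp L M -> perp M L.
Proof. by move=> pLM l m lM mL; case: (pLM m l). Qed.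

Lemma perpS L M L' M' : (L' <= L)%VS -> (M' <= M)%VS -> perp L M -> perp L' M'.
Proof. by move=> /subvP sL /subvP sM pLM l m /sL lL /sM mM; apply: pLM. Qed.

Lemma gradesign_degspace f k : f \in degspace V K k -> gradesign f = (-1) ^+ k *: f.
Proof.
move/degspaceP=> f0; apply/ffunP=> X; rewrite !ffunE /GRing.scale /=.
by have [->//|nX] := eqVneq #|X| k; rewrite f0 ?mulr0.
Qed.

Lemma wedgeZl a l m : wedge (a *: l) m = a *: wedge l m.
Proof.
apply/ffunP=> X; rewrite !ffunE scaler_sumr; apply: eq_bigr => Y _.
rewrite ffunE /GRing.scale /=; ring.
Qed.

(** Contract the vanishing product of [l] and [m]: since [th] kills [m], the Leibniz rule leaves
    only the contraction of [l] times [m]. In the other order the grade sign of [m] is a unit. *)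
Lemma perp_parts th L M b : (M <= degspace V K b)%VS -> perp L M ->
  perp (impart th L) (kerpart th M).
Proof.
move=> Mb pLM _ m /memv_imgP[l lL ->]; rewrite memv_cap memv_ker => /andP[mM /eqP dm].
have [lm ml] := pLM l m lL mM; split.
  have := contr_wedge th l m; rewrite lm dm linear0.
  by rewrite wedgel0 addr0 => <-.
have := contr_wedge th m l; rewrite ml dm linear0 wedge0l add0r.
rewrite (gradesign_degspace (subvP Mb _ mM)) wedgeZl => /esym/eqP.
by rewrite scaler_eq0 signr_eq0 => /eqP.
Qed.

(** Bits 1 and 0 are handled by [perp_parts], bits 0 and 0 by restriction to subspaces. *)
Lemma perp_res p q ths L M a b : (L <= degspace V K a)%VS -> (M <= degspace V K b)%VS ->
    size p = size q -> (size p <= size ths)%N -> (forall i, ~~ (nth false p i && nth false q i)) ->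
    (count id p <= a)%N -> (count id q <= b)%N ->
  perp L M -> perp (res p ths L) (res q ths M).
Proof.
elim: p q ths L M a b => [|x p IH] [|y q] [|th ths] L M a b //= La Mb [esz] sz dis ca cb pLM.
have dis' i : ~~ (nth false p i && nth false q i) by have := dis i.+1.
have kL : (kerpart th L <= degspace V K a)%VS by apply: subv_trans La; apply: capvSl.
have kM : (kerpart th M <= degspace V K b)%VS by apply: subv_trans Mb; apply: capvSl.
have := dis 0%N; clear dis; case: x ca => /=; case: y cb => //= cb ca _.
- case: a La kL ca => // a La kL ca; apply: (IH _ _ _ _ a b) => //.
    by apply/subvP=> _ /memv_imgP[g gX ->]; apply: contr_degspace; apply: subvP gX.
  exact: (perp_parts Mb pLM).
- case: b Mb kM cb => // b Mb kM cb; apply: (IH _ _ _ _ a b) => //.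
    by apply/subvP=> _ /memv_imgP[g gX ->]; apply: contr_degspace; apply: subvP gX.
  by apply: perp_sym; apply: (perp_parts La (perp_sym pLM)).
- by apply: (IH _ _ _ _ a b) => //; apply: perpS pLM; apply: capvSl.
Qed.

Lemma wedge_set0 l m : l \in degspace V K 0 -> wedge l m = l set0 *: m.
Proof.
move=> lh; apply/ffunP=> X; rewrite !ffunE (bigD1 set0) ?sub0set //= big1 => [|Y /andP[_ Y0]].
  by rewrite /inversions big_set0 expr0 mul1r setD0 addr0.
by move/degspaceP: lh => ->; rewrite ?cards_eq0 // mul0r mulr0.
Qed.

Lemma perp_degspace0 L M : (L <= degspace V K 0%N)%VS -> perp L M -> L = 0%VS \/ M = 0%VS.
Proof.
move=> L0 pLM; have [->|nL] := eqVneq L 0%VS; [by left | right].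
apply/eqP; rewrite -subv0; apply/subvP=> m mM; rewrite memv0.
have lL := memv_pick L; have [lm _] := pLM _ _ lL mM.
have lh := subvP L0 _ lL; move: lm; rewrite wedge_set0 // => /eqP.
rewrite scaler_eq0 => /orP[/eqP l0|//].
by have := degspace0P lh; rewrite l0 scale0r => /eqP; rewrite vpick0 (negbTE nL).
Qed.

(* Shifting moves the trailing pattern 0101.. of M to the complementary pattern
   1010.., and the wedge of the two resulting scalars would be nonzero. *)
Lemma dichotomy a ths L M : (L <= degspace V K a)%VS -> (M <= degspace V K a)%VS ->
    (2 * a < size ths)%N -> good ths L -> good ths M -> perp L M ->
  res (false :: alt a false) ths L = 0%VS \/ res (false :: alt a false) ths M = 0%VS.
Proof.
move=> La Ma sz gL gM pLM.
have [->|nL] := eqVneq (res (false :: alt a false) ths L) 0%VS; first by left.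
right; apply/eqP; rewrite -subv0.
have szalt b : size (alt a b) = (2 * a)%N by rewrite size_flatten /shape map_nseq sumn_nseq.
have calt b : count id (alt a b) = a.
  by rewrite count_flatten map_nseq sumn_nseq /=; case: b => /=; rewrite !add0n ?addn0 mul1n.
have := @perp_res (false :: alt a false) (false :: alt a true) ths L M a a La Ma.
rewrite /= !szalt !calt => /(_ erefl sz) pr.
have /pr/(_ (leqnn a) (leqnn a) pLM) {}pr : forall i, ~~ (nth false (false :: alt a false) i && nth false (false :: alt a true) i).
  case=> // i /=; elim: (a) i => [|n IH] [|[|i]] //=; exact: IH.
case: ths sz gL gM nL pr => // th ths /= sz [_ gL _] [_ gM _] nL pr.
have := @res_degspace (false :: alt a false) (th :: ths) L a La.
rewrite /= szalt calt subnn => /(_ sz (leqnn a)) L0.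
case: (perp_degspace0 L0 pr) => [e0|<-]; first by rewrite e0 eqxx in nL.
by apply: res_alt.
Qed.

End Recursion.

(** * Dimension bounds *)

Section Bounds.
Local Open Scope ring_scope.
Variables (V : finType) (K : fieldType).
Notation E := {ffun {set V} -> K^o}.
Notation W := {ffun V -> K^o}.
Implicit Types (L M X Y : {vspace E}) (f l m : E) (th : W) (ths : seq W) (p q : bitseq)
  (Z : nat -> {vspace E}).

(** Each step lowers [a + b] by one, matching the loss of one in exactness. The extra direction is
    for the leading 0 in [dichotomy]. *)
Definition setup ths Z (a b : nat) L M : Prop :=
  [/\ [/\ (a + b < size ths)%N, exact_along (a + b) ths Z & graded Z],
      good ths L /\ good ths M, (L <= Z a)%VS /\ (M <= Z b)%VS & perp L M].

Lemma setup_sym ths Z a b L M : setup ths Z a b L M -> setup ths Z b a M L.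
Proof.
case=> [] [sz eZ gZ] [gL gM] [La Mb] pLM; rewrite /setup addnC; split=> //.
exact: perp_sym.
Qed.

Lemma graded_cut th Z : graded Z -> graded (cut th Z).
Proof.
case=> Zh Zc Z0; split=> [k|eta k|].
- by apply: subv_trans (Zh k); apply: capvSl.
- apply/subvP=> f /memv_imgP[g gk ->]; move: gk; rewrite /cut !memv_cap !memv_ker => /andP[gZ /eqP g0].
  rewrite (subvP (Zc eta k)) ?memv_img //=.
  by rewrite contr_anti g0 linear0 oppr0.
- by rewrite /cut memv_cap Z0 memv_ker (contr_degspace0 th (subvP (Zh 0%N) _ Z0)) eqxx.
Qed.

Lemma setup_step th ths Z a b L M : setup (th :: ths) Z a.+1 b L M ->
  setup ths (cut th Z) a b (impart th L) (kerpart th M).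
Proof.
case=> [] [/= sz [eZ1 eZ] gZ] [[_ gL0 gL1] [_ gM0 gM1]] [La Mb] pLM.
have [Zh Zc Z0] := gZ; split=> //.
- by split=> //; exact: graded_cut.
- split; last exact: kerpartS.
  apply/subvP=> _ /memv_imgP[g gL ->]; rewrite memv_cap memv_ker contr_sq eqxx andbT.
  by apply: (subvP (Zc th a)); rewrite memv_img ?(subvP La).
- apply: perp_parts pLM; apply: subv_trans Mb _; exact: Zh.
Qed.

(** Exactness embeds the kernel part of [Z k] into the image part of [Z k.+1]. *)
Lemma dim_cut th ths Z d k : exact_along d (th :: ths) Z -> (k < d)%N ->
  (\dim (cut th Z k.+1) + \dim (cut th Z k) <= \dim (Z k.+1))%N.
Proof.
by move=> [eZ _] kd; rewrite (dim_parts th (Z k.+1)) addnC leq_add2r dimvS // eZ.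
Qed.

(** If [Z d.+1] vanished, exactness would force the cut to vanish in degree [d]; the base case is
    the monomial of the empty set in [Z 0]. *)
Lemma exact_along_neq0 d ths Z : (d <= size ths)%N -> exact_along d ths Z -> graded Z -> Z d != 0%VS.
Proof.
elim: d ths Z => [|d IH] ths Z sz eZ gZ.
  apply: contraTneq isT => Z0; have [_ _] := gZ; rewrite Z0 memv0 => /eqP/ffunP/(_ set0).
  by rewrite !ffunE eqxx => /eqP; rewrite oner_eq0.
case: ths sz eZ => // th ths sz [eZ1 eZ].
apply: contraNneq (IH ths _ sz eZ (graded_cut th gZ)) => Z0.
by rewrite -subv0; apply: subv_trans (eZ1 d (ltnSn d)) _; rewrite Z0 /impart limg0 subv0.
Qed.

Lemma impart_degspace0 th X : (X <= degspace V K 0%N)%VS -> impart th X = 0%VS.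
Proof.
move=> Xh; apply/eqP; rewrite -subv0; apply/subvP=> _ /memv_imgP[g gX ->].
by rewrite contr_degspace0 ?mem0v // (subvP Xh).
Qed.

Lemma kerpart_degspace0 th X : (X <= degspace V K 0%N)%VS -> kerpart th X = X.
Proof. by move=> Xh; apply/capv_idPl; rewrite lkerE -/(impart th X) impart_degspace0. Qed.

(** In degrees [a < b] it is used with [c = b - a - 1]: it then has [b] ones, the degree of [M], and
    [a + 1] zeros. *)
Definition low_pattern a c : bitseq := nseq c true ++ alt a.+1 false.

(** A nonzero scalar in [L] forces [M] to vanish, and then the dimension of [L] is at most one. *)
Lemma bound0 b ths Z L M : setup ths Z 0 b L M -> (\dim L + \dim M <= \dim (Z b))%N.
Proof.
case=> [] [sz eZ gZ] [gL gM] [La Mb] pLM; have [Zh Zc Z0] := gZ.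
have Lh : (L <= degspace V K 0%N)%VS by apply: subv_trans La (Zh 0%N).
case: (perp_degspace0 Lh pLM) => [->|->]; rewrite dimv0 ?add0n ?addn0; first exact: dimvS.
apply: leq_trans (dim_degspace0 Lh) _; rewrite lt0n dimv_eq0.
by apply: exact_along_neq0 eZ gZ; apply: ltnW.
Qed.

(* L and M are compared through lattice paths. The hypothesis of the second bound
   excludes, by the swaps res_swap and res_alt, every path of M that stays below
   the level b - a; the remaining ones can be reflected into degree a. *)
Lemma bounds n : forall a b, (a + b = n)%N -> forall ths Z L M, setup ths Z a b L M ->
  ((a <= b)%N -> (\dim L + \dim M <= \dim (Z b))%N) /\
  ((a < b)%N -> res (low_pattern a (b - a).-1) ths M = 0%VS -> (\dim L + \dim M <= \dim (Z a))%N).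
Proof.
elim: n => [|n IH] a b abn ths Z L M stp.
  have [-> ->] : (a = 0 /\ b = 0)%N by lia.
  by move: stp; have [-> ->] : (a = 0 /\ b = 0)%N by [lia]; split=> // _; exact: bound0 stp.
have T a' b' : (a' + b' = n)%N -> forall ths Z L M, setup ths Z a' b' L M ->
    (a' <= b')%N -> (\dim L + \dim M <= \dim (Z b'))%N.
  by move=> e ths' Z' L' M' stp'; case: (IH a' b' e ths' Z' L' M' stp').
have R a' b' : (a' + b' = n)%N -> forall ths Z L M, setup ths Z a' b' L M ->
    (a' < b')%N -> res (low_pattern a' (b' - a').-1) ths M = 0%VS ->
    (\dim L + \dim M <= \dim (Z a'))%N.
  by move=> e ths' Z' L' M' stp'; case: (IH a' b' e ths' Z' L' M' stp').
have [[sz eZ gZ] [gL gM] [La Mb] pLM] := stp; have [Zh Zc Z0] := gZ.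
case: ths sz eZ gL gM stp => // th ths sz eZ gL gM stp.
rewrite (dim_parts th L) (dim_parts th M).
split=> [leab|ltab r0].
- case: a abn sz eZ La stp leab => [|a] abn sz eZ La stp leab.
    by rewrite -!dim_parts; exact: bound0 stp.
  have stp1 := setup_step stp.
  case: b abn sz eZ Mb stp leab stp1 => // b abn sz eZ Mb stp leab stp1.
  have stp2 := setup_step (setup_sym stp).
  have lt1 : (b < a.+1 + b.+1)%N by lia.
  have dZ := dim_cut eZ lt1.
  (* In equal degrees the first bound puts both pairs under the cut in degree [b.+1], while [dZ] has
     room for one of them. The dichotomy lets the second bound put the other pair under degree
     [b]. *)
  have [eab|nab] := eqVneq a b; last first.
    have T1 : (\dim (impart th L) + \dim (kerpart th M) <= \dim (cut th Z b.+1))%N.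
      by apply: (T _ _ _ _ _ _ _ stp1); lia.
    have T2 : (\dim (kerpart th L) + \dim (impart th M) <= \dim (cut th Z b))%N.
      by apply: (T _ _ _ _ _ _ _ (setup_sym stp2)); lia.
    lia.
  rewrite eab in abn sz eZ La stp leab stp1 stp2 *.
  have low X : res (false :: alt b.+1 false) (th :: ths) X = 0%VS ->
    res (low_pattern b (b.+1 - b).-1) ths (kerpart th X) = 0%VS by rewrite subSnn.
  have Lh := subv_trans La (Zh _); have Mh := subv_trans Mb (Zh _).
  have szt : (2 * b.+1 < size (th :: ths))%N by lia.
  case: (dichotomy Lh Mh szt gL gM pLM) => /low r0.
    have RR : (\dim (impart th M) + \dim (kerpart th L) <= \dim (cut th Z b))%N.
      by apply: (R _ _ _ _ _ _ _ stp2) r0 => //; lia.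
    have TT : (\dim (impart th L) + \dim (kerpart th M) <= \dim (cut th Z b.+1))%N.
      by apply: (T _ _ _ _ _ _ _ stp1); lia.
    lia.
  have RR : (\dim (impart th L) + \dim (kerpart th M) <= \dim (cut th Z b))%N.
    by apply: (R _ _ _ _ _ _ _ stp1) r0 => //; lia.
  have TT : (\dim (impart th M) + \dim (kerpart th L) <= \dim (cut th Z b.+1))%N.
    by apply: (T _ _ _ _ _ _ _ stp2); lia.
  lia.
case: b abn sz eZ Mb stp ltab r0 => // b abn sz eZ Mb stp ltab r0.
have stp2 := setup_sym (setup_step (setup_sym stp)).
(* A leading 1 of the pattern is absorbed by the image part of [M]; if there is none, the two
   degrees are equal and the first bound applies. *)
have step01 : (\dim (kerpart th L) + \dim (impart th M) <= \dim (cut th Z a))%N.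
  have [eab|nab] := eqVneq a b.
    by rewrite eab in stp2 *; apply: (T _ _ _ _ _ _ _ stp2) => //; lia.
  apply: (R _ _ _ _ _ _ _ stp2); [lia|lia|].
  have e : (b.+1 - a).-1 = (b - a).-1.+1 by lia.
  by rewrite e in r0.
(* Moving the first zero to the front makes the part smaller, so the kernel part of [M] inherits a
   vanishing pattern with a longer run of ones. *)
have sw := @res_swap _ _ (b - a) (alt a false) (th :: ths) M.
have {sw} r1 : res (nseq (b - a).+1 true ++ alt a false) ths (kerpart th M) = 0%VS.
  apply/eqP; rewrite -subv0 -r0 /low_pattern subSn //= -/(kerpart th M); by apply: sw => //; move: sz => /=; lia.
case: a abn sz eZ La stp ltab r0 stp2 step01 r1 => [|a] abn sz eZ La stp ltab r0 stp2 step01 r1.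
  (* For [a = 0] the inherited pattern consists of ones only, as many as the degree of [M]. *)
  have k0 : kerpart th M = 0%VS.
    apply: (@res_nseq_true _ _ b.+1 ths); last by rewrite subn0 cats0 in r1.
    - by apply: subv_trans (Zh b.+1); apply: subv_trans Mb; apply: capvSl.
    - by move: sz => /=; lia.
    - by case: gM.
  have Lh : (L <= degspace V K 0%N)%VS by apply: subv_trans La (Zh 0%N).
  rewrite k0 dimv0 addn0 impart_degspace0 // dimv0 add0n.
  by move: step01; rewrite /cut (kerpart_degspace0 th (Zh 0%N)).
have stp1 := setup_step stp.
have lt1 : (a < a.+1 + b.+1)%N by lia.
have dZ := dim_cut eZ lt1.
have RR : (\dim (impart th L) + \dim (kerpart th M) <= \dim (cut th Z a))%N.
  apply: (R _ _ _ _ _ _ _ stp1); [lia|lia|].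
  rewrite /low_pattern.
  have e : (b - a.+1).+1 = (b.+1 - a).-1 by lia.
  by rewrite e in r1.
lia.
Qed.

Fixpoint cuts n ths Z := match n, ths with
  | n'.+1, th :: ths' => cuts n' ths' (cut th Z)
  | _, _ => Z end.

Lemma leq_add_split (l0 l1 m0 m1 c z z0 z1 : nat) :
    (z1 + z0 <= z)%N -> (l0 + m1 <= z0)%N -> (l1 + m0 + c <= z1 + 1)%N ->
  (l1 + l0 + (m1 + m0) + c <= z + 1)%N.
Proof. lia. Qed.

(* On the branch of constant pattern 1 for L and 0 for M, the first space is a line
   and the second is zero: all but one dimension of the last cut is saved. *)
Lemma bound_sharp_aux a b ths Z L M : (a < b)%N -> setup ths Z a b L M ->
  res (nseq a false) ths M = 0%VS ->
  (\dim L + \dim M + \dim (cuts a ths Z b) <= \dim (Z b) + 1)%N.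
Proof.
elim: a b ths Z L M => [|a IH] b ths Z L M ltab stp r0.
  have [[sz eZ [Zh _ _]] [gL gM] [La Mb] pLM] := stp.
  move: r0 => /= ->; rewrite dimv0 addn0 addnC leq_add2l.
  by apply: dim_degspace0; apply: subv_trans La (Zh 0%N).
case: ths stp r0 => [|th ths] stp r0; first by case: stp => [] [].
have stp1 := setup_step stp.
have [[sz eZ [Zh _ _]] [gL gM] [La Mb] pLM] := stp.
case: b ltab sz eZ Mb stp stp1 => // b ltab sz eZ Mb stp stp1.
have stp2 := setup_sym (setup_step (setup_sym stp)).
rewrite (dim_parts th L) (dim_parts th M) /=.
have lt1 : (b < a.+1 + b.+1)%N by lia.
have dZ := dim_cut eZ lt1.
apply: leq_add_split dZ _ (IH _ _ _ _ _ (ltnW ltab) stp1 r0).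
by have [T _] := bounds erefl stp2; exact: T ltab.
Qed.

(** The dichotomy decides which of the two pairs is bounded in degree [b] by the second bound; the
    other pair has degrees [b < b.+1] and receives the sharp estimate. Either case may occur, hence
    a vanishing hypothesis on each space. *)
Lemma bound_sharp r ths Z L M : (0 < r)%N -> setup ths Z r r L M ->
    res (nseq r false) ths L = 0%VS -> res (nseq r false) ths M = 0%VS ->
  (\dim L + \dim M + \dim (cuts r ths Z r) <= \dim (Z r) + 1)%N.
Proof.
case: r => // b _; case: ths => [|th ths] stp rL rM; first by case: stp => [] [].
have [[sz eZ [Zh _ _]] [gL gM] [La Mb] pLM] := stp.
have stp1 := setup_step stp; have stp2 := setup_step (setup_sym stp).
have lt1 : (b < b.+1 + b.+1)%N by lia.
have dZ := dim_cut eZ lt1.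
rewrite (dim_parts th L) (dim_parts th M) /=.
have low X : res (false :: alt b.+1 false) (th :: ths) X = 0%VS ->
  res (low_pattern b (b.+1 - b).-1) ths (kerpart th X) = 0%VS by rewrite subSnn.
have Lh := subv_trans La (Zh _); have Mh := subv_trans Mb (Zh _).
have szt : (2 * b.+1 < size (th :: ths))%N by lia.
case: (dichotomy Lh Mh szt gL gM pLM) => /low r0.
  have [_ R] := bounds erefl stp2.
  apply: leq_add_split dZ _ (bound_sharp_aux (ltnSn b) stp1 rM).
  by rewrite addnC; exact: R (ltnSn b) r0.
rewrite [X in (X + _ <= _)%N]addnC.
have [_ R] := bounds erefl stp1.
apply: leq_add_split dZ _ (bound_sharp_aux (ltnSn b) stp2 rL).
by rewrite addnC; exact: R (ltnSn b) r0.
Qed.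

End Bounds.

(** * Generic directions *)

Section Pencil.
Import VectorInternalTheory.
Local Open Scope ring_scope.
Variable (K : closedFieldType).

(** Cayley-Hamilton, with the characteristic polynomial split into linear factors. The factors are
    applied one at a time, in the form used by the surjectivity argument below. *)
Lemma mx_annihilated n (M : 'M[K]_n) :
  exists rs : seq K, forall v : 'rV[K]_n, foldr (fun r x => x *m M - r *: x) v rs = 0.
Proof.
case: n M => [|n] M; first by exists [::] => v; apply/rowP; case.
have [rs prs] := closed_field_poly_normal (char_poly M).
exists rs => v.
have -> : foldr (fun r x => x *m M - r *: x) v rs =
    v *m horner_mx M (\prod_(z <- rs) ('X - z%:P)).
  elim: (rs) => [|r s IH] /=; first by rewrite big_nil rmorph1 mulmx1.
  rewrite big_cons mulrC rmorphM IH /= -[_ * _]/(_ *m _) mulmxA.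
  by rewrite rmorphB /= horner_mx_X horner_mx_C mulmxBr mul_mx_scalar.
have := Cayley_Hamilton M; rewrite prs (monicP (char_poly_monic M)) scale1r => ->.
by rewrite mulmx0.
Qed.

Variable vT : vectType K.
Implicit Types (f g h : 'End(vT)) (U : {vspace vT}).

Lemma endo_annihilated h :
  exists rs : seq K, forall v, foldr (fun r x => h x - r *: x) v rs = 0.
Proof.
have [rs prs] := mx_annihilated (f2mx h).
exists rs => v; apply: (can_inj v2rK).
rewrite linear0 -[RHS](prs (v2r v)).
elim: (rs) => //= r s <-; rewrite linearB linearZ /=; congr (_ - _).
by rewrite unlock /= r2vK.
Qed.

(* If h - t is onto the quotient U / U0 for every scalar t, then h has no eigenvalue
   on U / U0, which must therefore vanish. *)
Lemma subv_of_surjective_pencil h U U0 :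
    (h @: U0 <= U0)%VS ->
    (forall t u, u \in U -> exists2 u', u' \in U & h u' - t *: u' - u \in U0) ->
  (U <= U0)%VS.
Proof.
move=> hU0 surj; have [rs prs] := endo_annihilated h.
apply/subvP=> u uU.
have [u' _] : exists2 u', u' \in U & foldr (fun r x => h x - r *: x) u' rs - u \in U0.
  elim: (rs) u uU => [|r s IH] u uU /=; first by exists u; rewrite // subrr mem0v.
  have [u1 u1U h1] := surj r u uU; have [u2 u2U h2] := IH u1 u1U.
  exists u2 => //; set y := foldr _ _ _ in h2 *.
  have -> : h y - r *: y - u = (h (y - u1) - r *: (y - u1)) + (h u1 - r *: u1 - u).
    by rewrite linearB scalerBr /= [RHS]addrA opprB; congr (_ - _); rewrite addrACA subrK addrAC subrr add0r.
  rewrite memvD // memvB // ?memvZ //; apply: (subvP hU0); exact: memv_img.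
by rewrite prs sub0r memvN.
Qed.

(* The operator g o f^-1 acts on the homology of g on U0 :&: ker f, and exactness of
   g - t f at U0 makes g o f^-1 - t surjective there. *)
Lemma pencil_exact f g U0 U1 U2 :
    (forall x, f (f x) = 0) -> (forall x, g (g x) = 0) -> (forall x, f (g x) = - g (f x)) ->
    (f @: U1 <= U0)%VS -> (g @: U1 <= U0)%VS -> (f @: U2 <= U1)%VS -> (g @: U2 <= U1)%VS ->
    (U0 :&: lker f <= f @: U1)%VS -> (U1 :&: lker f <= f @: U2)%VS ->
    (forall t, U0 :&: lker (g - t *: f) <= (g - t *: f) @: U1)%VS ->
  (U0 :&: lker f :&: lker g <= g @: (U1 :&: lker f))%VS.
Proof.
move=> ff gg fg f1 g1 f2 g2 ex0 ex1 pen.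
(* [s] chooses preimages under [f] inside [U1]. *)
pose s : 'End(vT) := (projv U1 \o (f \o projv U1)^-1)%VF.
have s1 x : s x \in U1 by rewrite comp_lfunE memv_proj.
have fs x : x \in (U0 :&: lker f)%VS -> f (s x) = x.
  move=> xU; rewrite -comp_lfunE /s comp_lfunA comp_lfunE limg_lfunVK //.
  have /memv_imgP[y yU ->] := subvP ex0 x xU.
  apply/memv_imgP; exists y; first exact: memvf.
  by rewrite comp_lfunE projv_id.
apply: (@subv_of_surjective_pencil (g \o s)%VF).
  (* Stability of the boundaries: if [y = f z], adding [g z] brings [s (g y)] into the kernel of [f]
     without changing its image under [g]. *)
  apply/subvP=> _ /memv_imgP[_ /memv_imgP[y yU ->] ->].
  have /memv_imgP[z zU ez] := subvP ex1 y yU.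
  rewrite comp_lfunE.
  have -> : g (s (g y)) = g (s (g y) + g z) by rewrite linearD /= gg addr0.
  apply: memv_img; rewrite memv_cap memvD ?s1 //=; last by apply: (subvP g2); apply: memv_img.
  rewrite memv_ker linearD /= fs; last first.
    move: yU; rewrite !memv_cap !memv_ker => /andP[yU /eqP fy].
    by rewrite fg fy linear0 oppr0 eqxx andbT; apply: (subvP g1); apply: memv_img.
  by rewrite fg ez addrN.
(* A cycle [u] is also killed by [g - t *: f], hence equals [g b - t *: f b] for some [b], and [f b]
   is the required preimage modulo boundaries. *)
move=> t u; rewrite !memv_cap !memv_ker => /andP[/andP[uU /eqP fu] /eqP gu].
have : u \in (U0 :&: lker (g - t *: f))%VS.
  by rewrite memv_cap uU memv_ker add_lfunE opp_lfunE scale_lfunE fu gu scaler0 subr0 eqxx.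
case/(subvP (pen t))/memv_imgP=> b bU; rewrite add_lfunE opp_lfunE scale_lfunE => eu.
have fbU0 : f b \in U0 by apply: (subvP f1); apply: memv_img.
exists (f b).
  rewrite !memv_cap !memv_ker fbU0 ff eqxx /=.
  have := congr1 f eu; rewrite fu linearB linearZ /= ff scaler0 subr0 fg => /eqP.
  by rewrite eq_sym oppr_eq0.
rewrite comp_lfunE.
have -> : g (s (f b)) - t *: f b - u = g (s (f b) - b).
  by rewrite linearB /= eu opprB addrA subrK.
apply: memv_img; rewrite memv_cap memvB ?s1 //= memv_ker linearB /= fs ?subrr //.
by rewrite memv_cap fbU0 memv_ker ff eqxx.
Qed.

End Pencil.

(** * Exactness along flags, and generic conditions on a direction *)

Section Generic.
Local Open Scope ring_scope.
Variables (V : finType) (K : closedFieldType).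
Notation E := {ffun {set V} -> K^o}.
Notation W := {ffun V -> K^o}.
Implicit Types (X Y : {vspace E}) (th eta : W) (ths prev : seq W) (Z : nat -> {vspace E}).

Fixpoint cutall prev Z := if prev is th :: prev' then cut th (cutall prev' Z) else Z.

Definition exact_at th Z j := (kerpart th (Z j) <= impart th (Z j.+1))%VS.

(** The head of [prev] is the latest direction. Its own flag is required in the two degrees [j] and
    [j.+1] in which [pencil_exact] needs it exact. *)
Fixpoint flagged prev g Z j : Prop :=
  (forall eta, eta \in <<prev>>%VS -> exact_at (g + eta) Z j) /\
  if prev is f :: prev' then flagged prev' f Z j /\ flagged prev' f Z j.+1 else True.

Lemma graded_cutall prev Z : graded Z -> graded (cutall prev Z).
Proof. by elim: prev => //= th prev IH /IH; exact: graded_cut. Qed.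

(** Induction through [pencil_exact], with [f] the latest cut direction: the members [g - t *: f] of
    the pencil satisfy the hypotheses for the shorter flag, since [t *: f] lies in the span of
    [prev]. *)
Lemma flag_exact prev g Z j : graded Z -> flagged prev g Z j -> exact_at g (cutall prev Z) j.
Proof.
move=> gZ; elim: prev g j => [|f prev IH] g j [ex_g fl].
  by have := ex_g 0 (mem0v _); rewrite addr0.
have [_ Zc _] := graded_cutall prev gZ.
case: fl => fl0 fl1; have ex0 := IH _ _ fl0; have ex1 := IH _ _ fl1.
apply: (pencil_exact (f := contr f) (U2 := cutall prev Z j.+2)) => //; try exact: contr_sq.
  exact: contr_anti.
move=> t; have -> : contr g - t *: contr f = contr (g - t *: f).
  by rewrite contrD -[- (t *: f)]scaleNr contrZ scaleNr.
apply: IH; case: prev {ex0 ex1 Zc} ex_g fl0 {fl1} => [|f' prev] ex_g [_ fl0]; split=> // eta he.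
  rewrite -addrA; apply: ex_g; rewrite span_cons memvD //; last by apply: (subvP (addvSr _ _)).
  by apply: (subvP (addvSl _ _)); rewrite memvN memvZ ?memv_line.
rewrite -addrA; apply: ex_g; rewrite span_cons memvD //; last by apply: (subvP (addvSr _ _)).
by apply: (subvP (addvSl _ _)); rewrite memvN memvZ ?memv_line.
Qed.

Definition vanishing th : {set V} := [set x | th x == 0].

Fixpoint general_position prev ths : Prop := if ths is th :: ths' then
  (forall eta, eta \in <<prev>>%VS -> (#|vanishing (th + eta)%R| <= size prev)%N) /\
  general_position (th :: prev) ths' else True.

(** Modulo the span of its [k] predecessors a direction has at most [k] zeros, so it is exact in
    sizes below [d - k]. The predecessors, with fewer zeros, are exact one degree higher, as
    [flagged] asks. *)
Lemma exact_along_general_position d Z ths prev : graded Z ->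
    (forall th u j, (#|vanishing th| <= u)%N -> (j + u < d)%N -> exact_at th Z j) ->
    general_position prev ths ->
    (if prev is f :: prev' then forall j, (j + size prev' < d)%N -> flagged prev' f Z j else True) ->
  exact_along (d - size prev) ths (cutall prev Z).
Proof.
move=> gZ exZ; elim: ths prev => //= th ths IH prev [gp1 gp2] fl.
have fl' j : (j + size prev < d)%N -> flagged prev th Z j.
  move=> hj; case: prev {IH gp2} gp1 fl hj => [|f prev] gp1 fl hj; split=> //.
  - by move=> eta he; apply: exZ (gp1 eta he) hj.
  - by move=> eta he; apply: exZ (gp1 eta he) hj.
  - by move: hj => /= hj; split; apply: fl; lia.
split; first by move=> j hj; apply: flag_exact gZ (fl' j _); lia.
by have := IH (th :: prev) gp2 fl'; rewrite /= subnS.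
Qed.

(** The polynomial is the determinant of the identity plus [t] times the matrix of coordinates of
    the second components along the first ones; its value at 0 is 1. *)
Lemma free_perturb (vT : vectType K) (s : seq (vT * vT)) : free [seq p.1 | p <- s] ->
  exists2 q : {poly K}, q != 0 & forall t, q.[t] != 0 -> free [seq p.1 + t *: p.2 | p <- s].
Proof.
move=> fs; set n := size s.
have sz1 : size [seq p.1 | p <- s] == n by rewrite size_map.
pose X := Tuple sz1; have fX : free X by [].
pose B : 'M[K]_n := \matrix_(i, j) coord X j (nth 0 [seq p.2 | p <- s] i).
pose P := (1%:M : 'M[{poly K}]_n) + 'X *: map_mx polyC B.
have Pt t : map_mx (horner_eval t) P = 1%:M + t *: B.
  by apply/matrixP=> i j; rewrite !mxE /horner_eval !hornerE /=; case: eqP; rewrite /= ?hornerE.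
exists (\det P).
  apply/eqP=> P0; have := congr1 (horner_eval 0) P0.
  rewrite -det_map_mx Pt scale0r addr0 det1 /horner_eval horner0 => /eqP.
  by rewrite oner_eq0.
move=> t; rewrite -/(horner_eval t _) -det_map_mx Pt => dt.
have sz2 : size [seq p.1 + t *: p.2 | p <- s] == n by rewrite size_map.
apply/(freeP (X := Tuple sz2)) => k k0.
have kM : (\row_i k i) *m (1%:M + t *: B) = 0.
  apply/rowP=> j; rewrite !mxE.
  apply: (etrans _ (etrans (congr1 (coord X j) k0) (linear0 _))); rewrite linear_sum /=.
  apply: eq_bigr => i _; rewrite !mxE linearZ /=; congr (_ * _).
  have hi : (i < size s)%N by exact: ltn_ord.
  have -> : nth 0 [seq p.1 + t *: p.2 | p <- s] i = (nth (0, 0) s i).1 + t *: (nth (0, 0) s i).2.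
    by rewrite (nth_map (0, 0)).
  rewrite linearD linearZ /=; congr (_ + _ * _).
    have -> : (nth (0, 0) s i).1 = X`_i by rewrite /= (nth_map (0, 0)).
    by rewrite coord_free // eq_sym.
  by rewrite (nth_map (0, 0)).
have uM : 1%:M + t *: B \in unitmx by rewrite unitmxE unitfE.
have /rowP r0 : \row_i k i = 0 by rewrite -(mulmxK uM (\row_i k i)) kM mul0mx.
by move=> i; have := r0 i; rewrite !mxE.
Qed.

(* A substitute for nonempty Zariski-open sets, stable under finite intersections. *)
Definition generic (P : W -> Prop) : Prop :=
  (exists th, P th) /\
  forall th eta, P th -> exists2 q : {poly K}, q != 0 & forall t, q.[t] != 0 -> P (th + t *: eta).

(** On the line through a point of [P] and a point of [Q] both conditions hold off finitely many
    parameters; [q3] accounts for the parameter [1 - t] of the reversed line. *)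
Lemma generic_and P Q : generic P -> generic Q -> generic (fun th => P th /\ Q th).
Proof.
move=> [[a Pa] gP] [[b Qb] gQ]; split; last first.
  move=> th eta [/(gP _ eta)[q1 n1 h1] /(gQ _ eta)[q2 n2 h2]].
  exists (q1 * q2); first by rewrite mulf_neq0.
  by move=> t; rewrite hornerM mulf_eq0 negb_or => /andP[/h1 ? /h2 ?].
have [q1 n1 h1] := gP a (b - a) Pa; have [q2 n2 h2] := gQ b (a - b) Qb.
pose q3 := q2 \Po (1%:P - 'X).
have n3 : q3 != 0.
  rewrite comp_poly_eq0 // -opprB size_polyN size_XsubC //.
have /closed_nonrootP[t] : q1 * q3 != 0 by rewrite mulf_neq0.
rewrite /root hornerM mulf_eq0 negb_or => /andP[/h1 Pt].
rewrite horner_comp !hornerE => /h2.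
have -> : b + (1 - t) *: (a - b) = a + t *: (b - a); last by move=> Qt; exists (a + t *: (b - a)).
by apply/ffunP=> x; rewrite !ffunE /GRing.scale /=; ring.
Qed.

Lemma generic_true : generic (fun _ => True).
Proof. by split; [exists 0 | move=> _ _ _; exists 1; rewrite ?oner_eq0]. Qed.

Lemma generic_all (A : eqType) (s : seq A) (P : A -> W -> Prop) :
  (forall a, a \in s -> generic (P a)) -> generic (fun th => forall a, a \in s -> P a th).
Proof.
elim: s => [|a s IH] gs.
  case: generic_true => [[x _] _]; split; first by exists x.
  by move=> th eta _; exists 1 => //; rewrite oner_eq0.
have ga := gs a (mem_head a s).
have /IH gss : forall b, b \in s -> generic (P b) by move=> b bs; apply: gs; rewrite in_cons bs orbT.
have [[th [h1 h2]] gl] := generic_and ga gss.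
split; first by exists th => b; rewrite in_cons => /predU1P[->|/h2].
move=> x eta h; case: (gl x eta).
  by split=> [|b bs]; apply: h; rewrite in_cons ?eqxx ?bs ?orbT.
move=> q q0 hq; exists q => // t /hq[u1 u2] b.
by rewrite in_cons => /predU1P[->|/u2].
Qed.

Definition max_rank X th := forall eta, (\dim (impart eta X) <= \dim (impart th X))%N.

Lemma image_basis th X : exists2 xs : seq E, {subset xs <= X} &
  <<[seq contr th x | x <- xs]>>%VS = impart th X /\ free [seq contr th x | x <- xs].
Proof.
pose U := (X :\: lker (contr th))%VS; exists (vbasis U).
  by move=> x /vbasis_mem; apply: (subvP (diffvSl _ _)).
have := limg_basis_of (f := contr th) (capv_diff X (lker (contr th))) (vbasisP U).
by rewrite limg_ker_compl => /andP[/eqP-> ->].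
Qed.

(** Ranks are bounded, so a maximum is attained. Lifts of a basis of the maximal image keep
    independent images for almost all perturbations. *)
Lemma generic_max_rank X : generic (max_rank X).
Proof.
split.
  suff H n : forall th, (\dim X - \dim (impart th X) <= n)%N -> exists th, max_rank X th.
    exact: (H (\dim X) 0 (leq_subr _ _)).
  elim: n => [|n IH] th hth.
    exists th => eta; rewrite (leq_trans (_ : _ <= \dim X)%N) //; last by lia.
    by rewrite (dim_parts eta X) leq_addr.
  have [h|h] := Classical_Prop.classic (max_rank X th); first by exists th.
  have [eta heta] : exists eta, (\dim (impart th X) < \dim (impart eta X))%N.
    apply: Classical_Prop.NNPP => no; apply: h => eta; rewrite leqNgt; apply/negP=> lt.
    by apply: no; exists eta.
  by apply: (IH eta); lia.
move=> th eta mr; have [xs xX [sx fx]] := image_basis th X.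
case: (@free_perturb _ [seq (contr th x, contr eta x) | x <- xs]); first by rewrite -map_comp.
move=> q q0 hq; exists q => // t /hq; rewrite -map_comp => ft eta'.
apply: leq_trans (mr eta') _; rewrite -sx.
move: fx ft; rewrite /free => /eqP-> /eqP/=; rewrite !size_map => <-.
apply: dimvS; apply/span_subvP=> _ /mapP[x /xX xx ->] /=.
by rewrite /impart contrD contrZ -scale_lfunE -add_lfunE memv_img.
Qed.

(** Otherwise, for almost all [t], the image of [th + t *: eta] contains [contr eta v] together with
    a perturbed basis of the image of [th], exceeding the maximal rank. The factor ['X] excludes
    [t = 0]. *)
Lemma max_rank_swap X th eta : max_rank X th -> (contr eta @: kerpart th X <= impart th X)%VS.
Proof.
move=> mr; apply/subvP=> w /memv_imgP[v vk ->]; move: vk.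
rewrite memv_cap memv_ker => /andP[vX /eqP v0]; apply: contraT => nin; have [xs xX [sx fx]] := image_basis th X.
case: (@free_perturb _ ((contr eta v, 0) :: [seq (contr th x, contr eta x) | x <- xs])).
  by rewrite /= -map_comp free_cons /= sx nin.
move=> q q0 hq.
have /closed_nonrootP[t] : q * 'X != 0 by rewrite mulf_neq0 // polyX_eq0.
rewrite /root hornerM hornerX mulf_eq0 negb_or => /andP[/hq + t0].
rewrite /= -map_comp scaler0 addr0 /free => /eqP /= dft.
have := mr (th + t *: eta); rewrite leqNgt -sx; move: fx; rewrite /free => /eqP->.
rewrite size_map; move: dft; rewrite size_map => <- /negP[]; apply: dimvS.
apply/span_subvP=> y; rewrite in_cons /impart contrD contrZ => /predU1P[->|/mapP[x /xX xx ->]] /=.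
  have -> : contr eta v = t^-1 *: (contr th + t *: contr eta)%VF v.
    by rewrite add_lfunE scale_lfunE v0 add0r scalerA mulVf // scale1r.
  by rewrite memvZ // memv_img.
by rewrite -scale_lfunE -add_lfunE memv_img.
Qed.

End Generic.

(** * Existence of a generic sequence *)

Section GenericExistence.
Local Open Scope ring_scope.
Variables (V : finType) (K : closedFieldType).
Notation E := {ffun {set V} -> K^o}.
Notation W := {ffun V -> K^o}.
Implicit Types (X Y : {vspace E}) (th eta : W) (ths prev : seq W) (Z : nat -> {vspace E}).

(** A line with a point off the subspace meets it at most once. *)
Lemma generic_notin (S : {vspace W}) : S != fullv -> generic (fun th => th \notin S).
Proof.
move=> nS; split.
  have /subvPn[th _ thS] : ~~ (fullv <= S)%VS by apply: contra nS => ?; rewrite eqEsubv subvf.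
  by exists th.
move=> th eta thS.
have [[t0 h0]|no] := Classical_Prop.classic (exists t0, th + t0 *: eta \in S); last first.
  by exists 1 => [|t _]; rewrite ?oner_eq0 //; apply/negP=> h; apply: no; exists t.
exists ('X - t0%:P); first by rewrite polyXsubC_eq0.
move=> t; rewrite !hornerE subr_eq0 => nt; apply: contra thS => ht.
have := memvB ht h0; rewrite opprD addrACA subrr add0r -scalerBl => hd.
have heta : eta \in S.
  by move: hd; rewrite rpredZeq subr_eq0 (negbTE nt).
by rewrite -(addrK (t0 *: eta) th) memvB ?memvZ.
Qed.

Lemma dirac_sum th : th = \sum_x th x *: dirac K x.
Proof.
apply/ffunP=> y; rewrite sum_ffunE (bigD1 y) //= big1 => [|x nxy].
  by rewrite !ffunE eqxx addr0 /GRing.scale /= mulr1.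
by rewrite !ffunE eq_sym (negbTE nxy) scaler0.
Qed.

(** The functionals that can be made to vanish on [U] by adding a combination of [prev]. *)
Definition off_span prev (U : {set V}) : {vspace W} :=
  (<<prev>> + <<[seq dirac K x | x <- enum (~: U)]>>)%VS.

Lemma off_span_neq prev (U : {set V}) : #|U| = (size prev).+1 -> off_span prev U != fullv.
Proof.
move=> cU; apply: contraTneq isT => e.
have := dimvf W; rewrite -e /= /dim /= => d.
have h1 : (\dim (off_span prev U) <= size prev + #|~: U|)%N.
  apply: leq_trans (dimv_add_leqif _ _) _; apply: leq_add; first exact: dim_span.
  by apply: leq_trans (dim_span _) _; rewrite size_map -cardE.
by move: h1; rewrite d muln1 -(cardsC U) cU leq_add2r ltnn.
Qed.

Lemma off_spanP prev (U : {set V}) th eta : eta \in <<prev>>%VS ->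
  (forall x, x \in U -> (th + eta) x = 0) -> th \in off_span prev U.
Proof.
move=> ep U0; rewrite -(addrK eta th) addrC memv_add ?memvN //.
rewrite (dirac_sum (th + eta)); apply: memv_suml => x _.
have [xU|xU] := boolP (x \in U); first by rewrite U0 // scale0r mem0v.
by apply/memvZ/memv_span/map_f; rewrite mem_enum inE.
Qed.

Lemma subset_card (A : {set V}) k : (k <= #|A|)%N -> exists2 U : {set V}, U \subset A & #|U| = k.
Proof.
move=> kA; exists [set x in take k (enum A)].
  by apply/subsetP=> x; rewrite inE => /mem_take; rewrite mem_enum.
rewrite cardsE (card_uniqP _) ?take_uniq ?enum_uniq // size_take -cardE.
by case: ltngtP kA.
Qed.

(** The next direction has maximal rank on all listed spaces and avoids every [off_span prev U]; the
    list is then replaced by all kernel and image parts. *)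
Lemma exists_good_sequence N : forall prev (Xs : seq {vspace E}),
  exists ths, [/\ size ths = N, forall X, X \in Xs -> good ths X & general_position prev ths].
Proof.
elim: N => [|N IH] prev Xs; first by exists [::].
have g1 : generic (fun th => forall X, X \in Xs -> max_rank X th).
  by apply: generic_all => X _; exact: generic_max_rank.
have g2 : generic (fun th => forall U : {set V}, U \in enum [set U : {set V} | #|U| == (size prev).+1] ->
    th \notin off_span prev U).
  by apply: generic_all => U; rewrite mem_enum inE => /eqP cU; apply/generic_notin/off_span_neq.
have [[th [h1 h2]] _] := generic_and g1 g2.
have [ths [sz gd gp]] := IH (th :: prev) ([seq kerpart th X | X <- Xs] ++ [seq impart th X | X <- Xs]).
exists (th :: ths); split; first by rewrite /= sz.
  move=> X XXs; split; first by move=> eta; apply: max_rank_swap; apply: h1.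
    by apply: gd; rewrite mem_cat map_f.
  by apply: gd; rewrite mem_cat map_f ?orbT.
split=> // eta ep; rewrite leqNgt; apply/negP=> /subset_card[U sU cU].
have /h2/negP[] : U \in enum [set U : {set V} | #|U| == (size prev).+1] by rewrite mem_enum inE cU.
by apply: off_spanP ep _ => x /(subsetP sU); rewrite inE => /eqP.
Qed.

End GenericExistence.

(** * Cohen-Macaulay complexes *)

Section CohenMacaulayExactness.
Local Open Scope ring_scope.
Variables (V : finType) (K : closedFieldType).
Notation E := {ffun {set V} -> K^o}.
Notation W := {ffun V -> K^o}.
Implicit Types (D : {set {set V}}) (S T X Y : {set V}) (f g h w : E) (th : W) (x : V).

Definition down_closed D := forall A B : {set V}, A \in D -> B \subset A -> B \in D.

Definition chains D k : {vspace E} := coordspace K (faces D k).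

Lemma chainsP D k f : (f \in chains D k) <-> (forall X, f X != 0 -> X \in D /\ #|X| = k).
Proof.
rewrite /chains coordspaceP; split=> h X.
  have [|XF /negP[]] := boolP (X \in faces D k); last by rewrite h.
  by rewrite inE => /andP[XD /eqP cX] _.
by apply: contraNeq => /h[XD cX]; rewrite inE XD cX eqxx.
Qed.

Lemma contr_neq0 th f X : contr th f X != 0 -> exists2 x, x \notin X & f (x |: X) != 0.
Proof.
rewrite contrE => nz; have [x /andP[xX h]|none] := pickP (fun x => (x \notin X) && (f (x |: X) != 0)).
  by exists x.
case/negP: nz; rewrite big1 // => x xX; have := none x; rewrite xX => /negbFE/eqP ->.
by rewrite !mulr0.
Qed.

Lemma graded_chains D : set0 \in D -> down_closed D -> graded (chains D).
Proof.
move=> D0 dD; split=> [k|th k|].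
- by apply: coordspaceS; apply/subsetP=> X; rewrite !inE => /andP[].
- apply/subvP=> _ /memv_imgP[f /chainsP fD ->]; apply/chainsP=> X /contr_neq0[x xX /fD[xXD]].
  rewrite cardsU1 xX add1n => -[cX]; split=> //; apply: dD xXD _; exact: subsetUr.
- by apply: memv_monom; rewrite inE D0 cards0 eqxx.
Qed.

Lemma contr_chains D th k f : down_closed D -> f \in chains D k.+1 -> contr th f \in chains D k.
Proof.
move=> dD /chainsP fD; apply/chainsP=> X /contr_neq0[x xX /fD[xXD]].
by rewrite cardsU1 xX add1n => -[cX]; split=> //; apply: dD xXD _; exact: subsetUr.
Qed.

Lemma exact_chainsP th D j : exact_at th (chains D) j <->
  (forall f, f \in chains D j -> contr th f = 0 -> exists2 h, h \in chains D j.+1 & contr th h = f).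
Proof.
split=> [/subvP ex f fD f0|ex].
  have /ex/memv_imgP[h hD ->] : f \in kerpart th (chains D j) by rewrite memv_cap fD memv_ker f0 eqxx.
  by exists h.
apply/subvP=> f; rewrite memv_cap memv_ker => /andP[fD /eqP f0].
by have [h hD <-] := ex f fD f0; exact: memv_img.
Qed.

Definition del D x : {set {set V}} := [set X in D | x \notin X].

Lemma down_closed_del D x : down_closed D -> down_closed (del D x).
Proof.
move=> dD A B; rewrite !inE => /andP[AD xA] BA; rewrite (dD A) //=.
by apply: contra xA; apply: (subsetP BA).
Qed.

Lemma down_closed_link D S : down_closed D -> down_closed (link D S).
Proof.
move=> dD A B; rewrite !inE => /andP[AD /andP[dis SA]] BA; rewrite (dD A B AD BA).
by rewrite (dD (S :|: A) (S :|: B) SA) ?setUS // (disjointWr BA dis).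
Qed.

Lemma link_set0 D : link D set0 = D.
Proof. by apply/setP=> X; rewrite inE set0U -setI_eq0 set0I eqxx /= andbb. Qed.

Lemma link_del D x S : x \notin S -> link (del D x) S = del (link D S) x.
Proof.
move=> xS; apply/setP=> X; rewrite !inE negb_or xS /=.
by case: (X \in D); case: (x \in X); rewrite ?andbF ?andbT.
Qed.

Lemma link_link D S T : down_closed D -> [disjoint S & T] -> link (link D S) T = link D (S :|: T).
Proof.
move=> dD ST; apply/setP=> X; rewrite !inE.
rewrite -![[disjoint _ & _]]setI_eq0 setIUl setU_eq0 setIUr setU_eq0 !setI_eq0 ST /= setUA.
case: (boolP (S :|: T :|: X \in D)) => [D1|_]; last by rewrite !andbF.
have -> : X \in D by apply: dD D1 _; exact: subsetUr.
have -> : S :|: X \in D by apply: dD D1 _; apply: setSU; exact: subsetUl.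
have -> : T :|: X \in D by apply: dD D1 _; apply: setSU; exact: subsetUr.
by rewrite !andbT /=; case: [disjoint S & X]; rewrite ?andbT ?andbF.
Qed.

Lemma chains_dirac D x k f : down_closed D -> f \in chains D k.+1 ->
  contr (dirac K x) f \in chains (link D [set x]) k.
Proof.
move=> dD /chainsP fD; apply/chainsP=> X; rewrite contr_dirac; case: ifP => xX; first by rewrite eqxx.
rewrite mulf_eq0 negb_or => /andP[_ /fD[xXD]]; rewrite cardsU1 xX add1n => -[cX]; split=> //.
by rewrite inE xXD disjoints1 xX (dD _ X xXD) // subsetUr.
Qed.

Lemma chains_creation D x k w : w \in chains (link D [set x]) k -> creation x w \in chains D k.+1.
Proof.
move=> /chainsP wD; apply/chainsP=> X; rewrite ffunE; case: ifP => xX; last by rewrite eqxx.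
rewrite mulf_eq0 negb_or => /andP[_ /wD[]]; rewrite inE setD1K // => /and3P[_ _ XD] cX.
by rewrite (cardsD1 x X) xX cX.
Qed.

Lemma chains_link_dirac0 D x k w : w \in chains (link D [set x]) k -> contr (dirac K x) w = 0.
Proof.
move=> /chainsP wD; apply/ffunP=> X; rewrite contr_dirac ffunE; case: ifP => // xX.
apply/eqP; rewrite mulf_eq0; apply/orP; right; apply: contraT => /wD[].
by rewrite inE disjoints1 setU11 andbF.
Qed.

Lemma chains_delP D x k f :
  (f \in chains (del D x) k) <-> (f \in chains D k /\ contr (dirac K x) f = 0).
Proof.
rewrite !chainsP; split=> [fD|[fD f0] X fX]; last first.
  have [XD cX] := fD X fX; split=> //; rewrite inE XD /=; apply: contraNN fX => xX.
  have := congr1 (fun g : E => g (X :\ x)) f0; rewrite contr_dirac !inE eqxx /= setD1K // ffunE.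
  by move=> /eqP; rewrite mulf_eq0 signr_eq0.
split=> [X /fD[]|]; first by rewrite inE => /andP[].
apply/ffunP=> X; rewrite contr_dirac ffunE; case: ifP => // xX.
apply/eqP; rewrite mulf_eq0; apply/orP; right; apply: contraT => /fD[].
by rewrite inE setU11 andbF.
Qed.

Lemma contr_dirac_creation D x k w : w \in chains (link D [set x]) k ->
  contr (dirac K x) (creation x w) = w.
Proof.
by move=> wD; rewrite contr_creation (chains_link_dirac0 wD) linear0 subr0 ffunE eqxx scale1r.
Qed.

Definition ones : W := [ffun=> 1].

(* Mayer-Vietoris for the deletion and the star of x. *)
Lemma exact_del D x j : down_closed D -> exact_at ones (chains D) j ->
    ([set x] \in D -> exact_at ones (chains (link D [set x])) j) ->
  exact_at ones (chains (del D x)) j.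
Proof.
move=> dD /exact_chainsP exD exL; apply/exact_chainsP=> g /chains_delP[gD gx] g0.
have [h hD eg] := exD g gD g0.
have h1L := chains_dirac x dD hD.
have h10 : contr ones (contr (dirac K x) h) = 0 by rewrite contr_anti eg gx oppr0.
have [w wL ew] : exists2 w, w \in chains (link D [set x]) j.+1 & contr ones w = contr (dirac K x) h.
  have [xD|xD] := boolP ([set x] \in D); first by have /exact_chainsP := exL xD; apply.
  exists 0; rewrite ?mem0v // linear0; apply/ffunP=> X; rewrite ffunE; apply/esym/eqP.
  apply: contraNT xD => nz; have [] := (chainsP _ _ _).1 h1L X nz.
  by rewrite inE => /and3P[_ _ xX] _; apply: dD xX _; exact: subsetUl.
exists (h + contr ones (creation x w)); last by rewrite linearD /= contr_sq addr0.
apply/chains_delP; split.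
  by rewrite memvD //; apply: contr_chains => //; exact: chains_creation.
by rewrite linearD /= contr_anti (contr_dirac_creation wL) ew subrr.
Qed.

(** Bounding by [d] instead of the largest face of the link keeps the condition stable under
    deletions and links, at a cost of one. *)
Definition acyclic_links D d : Prop := forall S, S \in D -> forall j, (j + #|S| < d)%N ->
  exact_at ones (chains (link D S)) j.

Lemma acyclic_links_del D x d : down_closed D -> acyclic_links D d -> acyclic_links (del D x) d.-1.
Proof.
move=> dD aD S; rewrite inE => /andP[SD xS] j hj; rewrite link_del //.
apply: exact_del; first exact: down_closed_link.
  by apply: aD => //; lia.
rewrite inE => /and3P[_ dis SxD]; rewrite link_link //; apply: aD => //.
by rewrite setUC cardsU1 xS; lia.
Qed.

Lemma acyclic_links_link D x d : down_closed D -> acyclic_links D d ->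
  acyclic_links (link D [set x]) d.-1.
Proof.
move=> dD aD S; rewrite inE => /and3P[SD dis xSD] j hj; rewrite link_link //.
by apply: aD => //; rewrite cardsU1 -disjoints1 dis; lia.
Qed.

(** Multiplying the coefficient at [X] by the product of the weights on [X] turns the weighted
    boundary into the ordinary one. Zero weights occur only off the vertices and are replaced by
    1. *)
Lemma exact_scale D th j : down_closed D -> (forall x, [set x] \in D -> th x != 0) ->
  exact_at ones (chains D) j -> exact_at th (chains D) j.
Proof.
move=> dD thD /exact_chainsP exD; apply/exact_chainsP=> f fD f0.
pose c x := if th x == 0 then 1 else th x.
have c0 x : c x != 0 by rewrite /c; case: ifP => [_|/negbT//]; rewrite oner_eq0.
pose C X := \prod_(x in X) c x.
have C0 X : C X != 0 by apply/prodf_neq0=> x _.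
pose sc (a : {set V} -> K) (f : E) : E := [ffun X : {set V} => a X * f X].
have scD a k g : g \in chains D k -> sc a g \in chains D k.
  by move=> /chainsP gD; apply/chainsP=> X; rewrite ffunE mulf_eq0 negb_or => /andP[_ /gD].
have scC k g : g \in chains D k -> contr ones (sc C g) = sc C (contr th g).
  move=> /chainsP gD; apply/ffunP=> X; rewrite contrE ffunE contrE mulr_sumr.
  apply: eq_bigr => x xX; rewrite !ffunE mul1r /C big_setU1 //=.
  have [->|nz] := eqVneq (g (x |: X)) 0; first by rewrite !mulr0.
  have xD : [set x] \in D by apply: dD (gD _ nz).1 _; exact: subsetUl.
  by rewrite {1}/c (negbTE (thD x xD)); ring.
case: (exD (sc C f)); first exact: scD.
  by rewrite (scC _ _ fD) f0; apply/ffunP=> X; rewrite !ffunE mulr0.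
move=> h hD eh; exists (sc (fun X => (C X)^-1) h); first exact: scD.
have := scC _ _ (scD (fun X => (C X)^-1) _ _ hD).
have -> : sc C (sc (fun X => (C X)^-1) h) = h.
  by apply/ffunP=> X; rewrite !ffunE mulrA divff // mul1r.
rewrite eh => /ffunP e; apply/ffunP=> X; have := e X; rewrite ffunE [RHS]ffunE.
by move/(mulfI (C0 X)).
Qed.

(** Induction on the number of vertices where [th] vanishes. At such a vertex [x] the contraction
    anticommutes with [creation x], so the complex splits into the deletion and a copy of the link
    of [x], each with one zero and one unit of depth less. *)
Lemma exact_of_acyclic_links u : forall D d th j, down_closed D -> acyclic_links D d ->
    (#|[set x in vanishing th | [set x] \in D]| <= u)%N -> (j + u < d)%N ->
  exact_at th (chains D) j.
Proof.
elim: u => [|u IH] D d th j dD aD cz hj.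
  apply: exact_scale => // [x xD|].
    move: cz; rewrite leqn0 cards_eq0 => /eqP/setP/(_ x); rewrite !inE xD andbT => /negbT//.
  have [D0|D0] := boolP (set0 \in D).
    by rewrite -[D]link_set0; apply: aD => //; rewrite cards0.
  apply/exact_chainsP=> f /chainsP fD _; exists 0; rewrite ?mem0v // linear0.
  apply/ffunP=> X; rewrite ffunE; apply/esym/eqP; apply: contraNT D0 => /fD[XD _].
  by apply: dD XD _; exact: sub0set.
have [z0|[x]] := set_0Vmem [set x in vanishing th | [set x] \in D].
  by apply: (IH D d) => //; [rewrite z0 cards0|lia].
rewrite inE => /andP[]; rewrite inE => /eqP thx xD.
have zx (D' : {set {set V}}) : (forall y, [set y] \in D' -> [set y] \in D /\ y != x) ->
    (#|[set y in vanishing th | [set y] \in D']| <= u)%N.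
  move=> sD; rewrite -ltnS; apply: leq_trans cz; apply: proper_card.
  apply/properP; split.
    by apply/subsetP=> y; rewrite !inE => /andP[-> /sD[->]].
  by exists x; rewrite !inE thx eqxx //=; apply/negP=> /sD[_]; rewrite eqxx.
have /exact_chainsP exdel : exact_at th (chains (del D x)) j.
  apply: (IH _ d.-1); [exact: down_closed_del|exact: acyclic_links_del| |lia].
  by apply: zx => y; rewrite !inE eq_sym => /andP[].
have exlink j' : j = j'.+1 -> exact_at th (chains (link D [set x])) j'.
  move=> ej; apply: (IH _ d.-1); [exact: down_closed_link|exact: acyclic_links_link| |lia].
  by apply: zx => y; rewrite inE disjoints1 !inE eq_sym => /and3P[].
apply/exact_chainsP=> g gD g0.
have [w wL ew] : exists2 w, w \in chains (link D [set x]) j & contr th w = contr (dirac K x) g.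
  case: j hj gD exlink exdel => [|j] hj gD exlink exdel.
    exists 0; rewrite ?mem0v // linear0 contr_degspace0 //.
    by apply: (subvP (coordspaceS K _)) gD; apply/subsetP=> X; rewrite !inE => /andP[].
  have /exact_chainsP := exlink j erefl; apply; first exact: chains_dirac.
  by rewrite contr_anti g0 linear0 oppr0.
have cx f : contr th (creation x f) = - creation x (contr th f) by rewrite contr_creation thx scale0r sub0r.
(* The component of [g] on the faces containing [x]. *)
pose g1 := creation x (contr (dirac K x) g).
have g1D : g1 \in chains D j.
  case: j hj gD exlink exdel wL => [|j] hj gD exlink exdel wL.
    rewrite /g1 contr_degspace0 ?linear0 ?mem0v //.
    by apply: (subvP (coordspaceS K _)) gD; apply/subsetP=> X; rewrite !inE => /andP[].
  exact/chains_creation/chains_dirac.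
have [h0 /chains_delP[h0D _] eh0] : exists2 h0, h0 \in chains (del D x) j.+1 & contr th h0 = g - g1.
  apply: exdel.
    apply/chains_delP; split; first by rewrite memvB.
    rewrite linearB /= /g1 contr_creation contr_sq linear0 subr0 ffunE eqxx scale1r subrr //.
  by rewrite linearB /= g0 /g1 cx contr_anti g0 linear0 oppr0 linear0 oppr0 subr0.
exists (h0 - creation x w); first by rewrite memvB // chains_creation.
by rewrite linearB /= eh0 cx ew opprK subrK.
Qed.

End CohenMacaulayExactness.

(** * Change of the ground field *)

Section PrimeField.
Local Open Scope ring_scope.

Lemma rank_intr_morph (F L : fieldType) (phi : {rmorphism F -> L}) m n (A : 'M[int]_(m, n)) :
  \rank (map_mx intr A : 'M[L]_(m, n)) = \rank (map_mx intr A : 'M[F]_(m, n)).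
Proof.
rewrite -[RHS](mxrank_map phi); congr (\rank _); apply/matrixP=> i j; rewrite !mxE.
by rewrite rmorph_int.
Qed.

Section CharZero.
Variable F : fieldType.
Hypothesis ch0 : [pchar F] =i pred0.

Lemma intr_neq0 (a : int) : a != 0 -> (a%:~R : F) != 0.
Proof.
have nat_neq0 n : (n.+1%:R : F) != 0.
  by rewrite natf_neq0_pchar; apply/pnatP=> // p _ _; rewrite inE /= ch0.
by case: a => [[|n]|n] //= _; rewrite ?NegzE ?rmorphN ?oppr_eq0 /= -?pmulrn.
Qed.

Lemma ratr_frac (a b : int) : b != 0 -> ratr (a%:~R / b%:~R) = a%:~R / b%:~R :> F.
Proof.
move=> b0; set x : rat := _ / _; rewrite /ratr.
have d0 := denq_neq0 x.
have e : a * denq x = numq x * b.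
  apply: (@intr_inj rat); rewrite !rmorphM /=.
  have bq : (b%:~R : rat) != 0 by rewrite intr_eq0.
  have dq : ((denq x)%:~R : rat) != 0 by rewrite intr_eq0.
  have : x = (numq x)%:~R / (denq x)%:~R by rewrite divq_num_den.
  rewrite {1}/x => /(congr1 (fun y => y * (b%:~R * (denq x)%:~R))).
  rewrite mulrA divfK // => ->.
  by rewrite mulrCA divfK // mulrC.
have := congr1 (fun y : int => y%:~R : F) e; rewrite !rmorphM /= => eF.
by apply/eqP; rewrite eqr_div ?intr_neq0 // -eF.
Qed.

Lemma ratr_zmod : zmod_morphism (ratr : rat -> F).
Proof.
move=> x y; have dx := denq_neq0 x; have dy := denq_neq0 y.
have dxF := intr_neq0 dx; have dyF := intr_neq0 dy.
have dxQ : ((denq x)%:~R : rat) != 0 by rewrite intr_eq0.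
have dyQ : ((denq y)%:~R : rat) != 0 by rewrite intr_eq0.
have -> : x - y = (numq x * denq y - numq y * denq x)%:~R / (denq x * denq y)%:~R.
  rewrite -[x in LHS]divq_num_den -[y in LHS]divq_num_den rmorphB !rmorphM /=.
  by field; rewrite ?dxQ ?dyQ.
rewrite ratr_frac ?mulf_neq0 // rmorphB !rmorphM /= /ratr.
by field; rewrite ?dxF ?dyF.
Qed.

Lemma ratr_monoid : monoid_morphism (ratr : rat -> F).
Proof.
split; first by rewrite /ratr (_ : denq 1 = 1) // (_ : numq 1 = 1) // divr1.
move=> x y; have dx := denq_neq0 x; have dy := denq_neq0 y.
have dxF := intr_neq0 dx; have dyF := intr_neq0 dy.
have dxQ : ((denq x)%:~R : rat) != 0 by rewrite intr_eq0.
have dyQ : ((denq y)%:~R : rat) != 0 by rewrite intr_eq0.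
have -> : x * y = (numq x * numq y)%:~R / (denq x * denq y)%:~R.
  rewrite -[x in LHS]divq_num_den -[y in LHS]divq_num_den !rmorphM /=.
  by field; rewrite ?dxQ ?dyQ.
rewrite ratr_frac ?mulf_neq0 // !rmorphM /= /ratr.
by field; rewrite ?dxF ?dyF.
Qed.

(** The hypothesis on the characteristic is an argument, so that the morphism structures can be
    attached to this map. *)
Definition ratr_char0 of [pchar F] =i pred0 : rat -> F := ratr.
HB.instance Definition _ :=
  GRing.isZmodMorphism.Build rat F (ratr_char0 ch0) ratr_zmod.
HB.instance Definition _ :=
  GRing.isMonoidMorphism.Build rat F (ratr_char0 ch0) ratr_monoid.
End CharZero.

(* Ranks of integer matrices only depend on the characteristic, and the prime field,
   being countable, has an algebraic closure in the library. *)
Lemma closed_field_same_rank (F : fieldType) : exists K : closedFieldType,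
  forall m n (A : 'M[int]_(m, n)),
    \rank (map_mx intr A : 'M[K]_(m, n)) = \rank (map_mx intr A : 'M[F]_(m, n)).
Proof.
have [[p chp]|no] := Classical_Prop.classic (exists p, p \in [pchar F]).
  have [K [phi _]] := countable_algebraic_closure 'F_p.
  exists K => m n A; rewrite (rank_intr_morph phi).
  pose psi : {rmorphism 'F_p -> F} :=
    (GRing.in_alg (pPrimeCharType chp) : {rmorphism 'F_p -> pPrimeCharType chp}).
  exact: esym (rank_intr_morph psi A).
have ch0 : [pchar F] =i pred0.
  by move=> p; apply/idP=> chp; apply: no; exists p.
have [K [phi _]] := countable_algebraic_closure rat.
exists K => m n A; rewrite (rank_intr_morph phi).
exact: esym (rank_intr_morph (ratr_char0 ch0 : {rmorphism rat -> F}) A).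
Qed.

End PrimeField.

(** * Boundary matrices and purity *)

Section BoundaryMatrix.
Local Open Scope ring_scope.
Variables (V : finType).

Definition bd_int (D : {set {set V}}) (k : nat) : 'M[int]_(#|faces D k|, #|faces D k.-1|) :=
  \matrix_(i, j)
    let A : {set V} := enum_val (A := faces D k) i in
    let B : {set V} := enum_val (A := faces D k.-1) j in
    \sum_(x in A | B == A :\ x) (-1) ^+ #|[set w in A | (enum_rank w < enum_rank x)%N]|.

Lemma bd_intE (F : fieldType) D k : bd F D k = map_mx intr (bd_int D k).
Proof.
apply/matrixP=> i j; rewrite !mxE /= rmorph_sum /=; apply: eq_bigr => x _.
by rewrite rmorphXn rmorphN rmorph1.
Qed.

Lemma red_hom_vanishes_rank (F K : fieldType) (D : {set {set V}}) k :
  (forall m n (A : 'M[int]_(m, n)),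
    \rank (map_mx intr A : 'M[K]_(m, n)) = \rank (map_mx intr A : 'M[F]_(m, n))) ->
  red_hom_vanishes F D k -> red_hom_vanishes K D k.
Proof. by move=> eqr; rewrite /red_hom_vanishes !bd_intE !eqr. Qed.

Variable K : closedFieldType.
Notation E := {ffun {set V} -> K^o}.
Implicit Types (D : {set {set V}}) (f g h : E).

Definition coords D k f : 'rV[K]_#|faces D k| := \row_i f (enum_val i).
Definition of_coords D k (v : 'rV[K]_#|faces D k|) : E := \sum_i v 0 i *: monom K (enum_val i).

Lemma of_coords_chains D k v : @of_coords D k v \in chains K D k.
Proof. by apply: memv_suml => i _; apply/memvZ/memv_monom/enum_valP. Qed.

Lemma of_coordsK D k : cancel (@of_coords D k) (@coords D k).
Proof.
move=> v; apply/rowP=> i; rewrite mxE sum_ffunE (bigD1 i) //= big1 => [|j nji].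
  by rewrite !ffunE eqxx addr0 /GRing.scale /= mulr1.
by rewrite !ffunE (inj_eq enum_val_inj) eq_sym (negbTE nji) scaler0.
Qed.

Lemma coords_inj D k : {in chains K D k &, injective (@coords D k)}.
Proof.
move=> f g fD gD /rowP e; apply/ffunP=> X.
have [XD|XD] := boolP (X \in faces D k).
  by have := e (enum_rank_in XD X); rewrite !mxE enum_rankK_in.
by move: fD gD => /coordspaceP -> // /coordspaceP ->.
Qed.

Lemma coords_bd D k f : down_closed D -> f \in chains K D k.+1 ->
  coords D k.+1 f *m bd K D k.+1 = coords D k (contr (ones V K) f).
Proof.
move=> dD fD; apply/rowP=> j; rewrite [RHS]mxE contrE mxE.
set B : {set V} := enum_val j.
under eq_bigr => i _ do rewrite !mxE /= -/B.
rewrite -(big_enum_val (fun A : {set V} => f A *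
  \sum_(x in A | B == A :\ x) (-1) ^+ before x A)) /=.
transitivity (\sum_(A : {set V}) \sum_(x | (x \in A) && (B == A :\ x)) f A * (-1) ^+ before x A).
  rewrite big_mkcond /=; apply: eq_bigr => A _; case: ifP => AD; first by rewrite mulr_sumr.
  by have /coordspaceP -> := fD; rewrite ?AD // big1 // => x _; rewrite mul0r.
rewrite (exchange_big_dep predT) //= [RHS]big_mkcond /=; apply: eq_bigr => x _.
case: ifP => xB; last first.
  by rewrite big1 // => A /andP[xA /eqP eB]; rewrite eB !inE eqxx in xB.
rewrite (big_pred1 (x |: B)) => [|A].
  by rewrite ffunE mul1r before_self mulrC.
rewrite /=; apply/andP/eqP => [[xA /eqP ->]|->]; first by rewrite setD1K.
by rewrite setU11 setU1K.
Qed.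

(** The rank identity says that the image, which is contained in the kernel, has the same
    dimension. *)
Lemma exact_of_red_hom D k : down_closed D -> red_hom_vanishes K D k ->
  exact_at (ones V K) (chains K D) k.
Proof.
move=> dD hk; apply/exact_chainsP=> f fD f0.
have dd : bd K D k.+1 *m bd K D k = 0.
  apply/row_matrixP=> i; rewrite row0 row_mul rowE.
  set u := delta_mx 0 i; rewrite -[u](of_coordsK (k := k.+1)).
  rewrite (coords_bd dD (of_coords_chains _)).
  (* For [k = 0] the matrix [bd K D 0] is zero, as the empty face has no element to sum over. *)
  case: k {hk fD f0} i u => [|k] i u; last first.
    rewrite coords_bd ?contr_sq //; last by apply: contr_chains => //; exact: of_coords_chains.
    by apply/rowP=> j; rewrite !mxE ffunE.
  apply/rowP=> j; rewrite !mxE big1 // => l _; rewrite !mxE /= big1 ?mulr0 // => x /andP[xA _].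
  by have := enum_valP l; rewrite inE cards_eq0 => /andP[_ /eqP A0]; rewrite A0 inE in xA.
have fk : coords D k f *m bd K D k = 0.
  case: k hk fD f0 dd => [|k] hk fD f0 dd; last first.
    by rewrite (coords_bd dD fD) f0; apply/rowP=> j; rewrite !mxE ffunE.
  apply/rowP=> j; rewrite !mxE big1 // => l _; rewrite !mxE /= big1 ?mulr0 // => x /andP[xA _].
  by have := enum_valP l; rewrite inE cards_eq0 => /andP[_ /eqP A0]; rewrite A0 inE in xA.
have ker_im : (kermx (bd K D k) <= bd K D k.+1)%MS.
  have /mxrank_leqif_sup[_ <-] : (bd K D k.+1 <= kermx (bd K D k))%MS by apply/sub_kermxP.
  by rewrite mxrank_ker -(addKn (\rank (bd K D k)) (\rank (bd K D k.+1))) -hk.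
have /submxP[u eu] : (coords D k f <= bd K D k.+1)%MS.
  by apply: submx_trans ker_im; apply/sub_kermxP.
exists (of_coords u); first exact: of_coords_chains.
apply: (coords_inj (D := D) (k := k)) => //; first by apply: contr_chains => //; exact: of_coords_chains.
by rewrite -coords_bd ?of_coords_chains // of_coordsK.
Qed.

End BoundaryMatrix.

(** * Purity from connectedness of links *)

Section Purity.
Local Open Scope ring_scope.
Variables (V : finType) (K : closedFieldType).
Implicit Types (D : {set {set V}}) (A B G X : {set V}).

Lemma maxsize_ge D A : A \in D -> (#|A| <= maxsize D)%N.
Proof. by move=> AD; rewrite /maxsize (bigD1 A) //= leq_maxl. Qed.

Lemma maxsize_attained D : D != set0 -> exists2 A, A \in D & #|A| = maxsize D.
Proof.
case/set0Pn=> A0 A0D.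
have c0 : (0 < #|D|)%N by apply/card_gt0P; exists A0.
have [A AD e] := eq_bigmax_cond (fun A : {set V} => #|A|) c0.
by exists A.
Qed.

(* The size of the largest faces containing A. *)
Definition topsize D A := (maxsize (link D A) + #|A|)%N.

Lemma topsize_ge D A G : down_closed D -> G \in D -> A \subset G -> (#|G| <= topsize D A)%N.
Proof.
move=> dD GD AG; rewrite /topsize -(cardsID A G) (setIidPr AG) addnC leq_add2r.
apply: maxsize_ge; rewrite inE.
rewrite (dD G (G :\: A) GD (subsetDl _ _)) -setI_eq0 /=.
have -> : A :|: G :\: A = G.
  by apply/setP=> z; rewrite !inE; case: (boolP (z \in A)) => //= /(subsetP AG) ->.
by rewrite GD andbT; apply/eqP/setP=> z; rewrite !inE; case: (z \in A).
Qed.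

Lemma topsize_attained D A : down_closed D -> A \in D ->
  exists2 G, G \in D & A \subset G /\ #|G| = topsize D A.
Proof.
move=> dD AD; have nL : link D A != set0.
  apply/set0Pn; exists set0; rewrite inE setU0 AD -setI_eq0 setI0 eqxx /= andbT.
  by apply: dD AD (sub0set _).
have [B] := maxsize_attained nL; rewrite inE => /and3P[BD dis ABD] cB.
exists (A :|: B) => //; split; first exact: subsetUl.
by rewrite cardsU (eqP (_ : A :&: B == set0)) ?setI_eq0 // cards0 subn0 cB addnC.
Qed.

(** The difference of the points [x] and [y] is the boundary of some [h]. No edge leaves [P], so
    this boundary sums to zero over [P]; if [P y] failed, the sum would be 1. *)
Lemma exact_one_connected D (P : pred V) x y : down_closed D ->
    exact_at (ones V K) (chains K D) 1 -> [set x] \in D -> [set y] \in D ->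
    (forall u z, u != z -> [set u; z] \in D -> P u = P z) ->
  P x -> P y.
Proof.
move=> dD /exact_chainsP ex xD yD Padj Px; apply: contraT => nPy.
have sg0 z : sgn K z set0 = 1.
  by rewrite /sgn /before (_ : [set w in set0 | _] = set0) ?cards0 //; apply/setP=> w; rewrite !inE.
case: (ex (monom K [set x] - monom K [set y])).
- by rewrite memvB // memv_monom // inE ?xD ?yD cards1.
- apply/ffunP=> X; rewrite contrE [RHS]ffunE.
  have [->|nX] := eqVneq X set0; last first.
    rewrite big1 // => z zX; rewrite !ffunE.
    have h u : (z |: X == [set u]) = false.
      apply/negP=> /eqP/(congr1 (fun A : {set V} => #|A|)); rewrite cards1 cardsU1 zX => -[/eqP].
      by rewrite cards_eq0 (negbTE nX).
    by rewrite !h subr0 !mulr0.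
  rewrite (eq_bigr (fun z => (z == x)%:R - (z == y)%:R)); last first.
    by move=> z _; rewrite !ffunE sg0 !mul1r setU0 !(inj_eq set1_inj).
  rewrite (eq_bigl predT) ?sumrB; last by move=> z; rewrite inE.
  have s1 (w : V) : \sum_z (z == w)%:R = 1 :> K.
    by rewrite (bigD1 w) //= eqxx big1 ?addr0 // => z /negbTE ->.
  by rewrite !s1 subrr.
move=> h hD eh.
have : \sum_(z | P z) (contr (ones V K) h) [set z] = 0.
  pose c u z := [&& P u, P z & u != z].
  transitivity (\sum_z \sum_(u | c z u) sgn K u [set z] * h [set u; z]).
    rewrite [LHS]big_mkcond; apply: eq_bigr => z _; case: ifP => Pz; last first.
      by rewrite big1 // => u; rewrite /c Pz.
    rewrite contrE (bigID P) /= [X in _ + X]big1 ?addr0.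
      apply: eq_big => [u|u _]; last by rewrite ffunE mul1r.
      by rewrite /c Pz inE /= eq_sym andbC.
    move=> u /andP[]; rewrite inE => nuz nPu.
    have [h0|nh] := eqVneq (h [set u; z]) 0; first by rewrite h0 !mulr0.
    have [uzD _] := (chainsP _ _ _).1 hD _ nh.
    by rewrite (Padj u z nuz uzD) Pz in nPu.
  apply: sum_antisym.
  - by move=> u z; rewrite /c eq_sym; case: (P u); case: (P z).
  - by move=> u; rewrite /c eqxx !andbF.
  - move=> z u /and3P[_ _ nzu]; rewrite setUC -[RHS]mulNr; congr (_ * _).
    have := @sgn_anti V K u z set0; rewrite eq_sym nzu !inE => /(_ isT isT isT).
    by rewrite !sg0 !mul1r !setU0 => ->; rewrite opprK.
rewrite eh (bigD1 x) //= big1 => [|z /andP[Pz nzx]].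
  rewrite !ffunE eqxx addr0 (inj_eq set1_inj).
  have -> : (x == y) = false by apply: contraNF nPy => /eqP <-.
  by rewrite subr0 => /eqP; rewrite oner_eq0.
rewrite !ffunE !(inj_eq set1_inj) (negbTE nzx).
have -> : (z == y) = false by apply: contraNF nPy => /eqP <-.
by rewrite subr0.
Qed.

(** Descending induction on the size of [A]. Adjacent points [u] and [z] of the link give the same
    value, that of [A] with both added; connectedness of the link carries the value from a point of
    a largest face to [x]. *)
Lemma topsizeU1 D A x : down_closed D ->
    (forall S, S \in D -> forall k, (k < maxsize (link D S))%N -> exact_at (ones V K) (chains K (link D S)) k) ->
    x \notin A -> x |: A \in D -> topsize D (x |: A) = topsize D A.
Proof.
move=> dD exD; have [n] := ubnP (#|V| - #|A|); elim: n A x => // n IH A x hn xA xAD.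
have AD : A \in D by apply: dD xAD _; exact: subsetUr.
have le y : y \notin A -> y |: A \in D -> (topsize D (y |: A) <= topsize D A)%N.
  move=> yA yAD; have [G GD [sG <-]] := topsize_attained dD yAD.
  by apply: topsize_ge => //; apply: subset_trans sG; exact: subsetUr.
have ltA : (#|A| < #|V|)%N.
  by rewrite -cardsT; apply: proper_card; apply/properP; split; [exact: subsetT|exists x; rewrite ?inE].
have hn' : (#|V| - (1 + #|A|) < n)%N by lia.
have mem_link y : y \notin A -> y |: A \in D -> [set y] \in link D A.
  move=> yA yAD; rewrite inE setUC yAD disjoint_sym disjoints1 yA (dD _ [set y] yAD) //=.
  exact: subsetUl.
have m1 : (1 <= maxsize (link D A))%N.
  by rewrite -(cards1 x); apply: maxsize_ge; apply: mem_link.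
apply/eqP; rewrite eqn_leq le //=.
have [m2|m2] := ltnP 1 (maxsize (link D A)); last first.
  by rewrite /topsize cardsU1 xA; lia.
have [G GD [sG cG]] := topsize_attained dD AD.
have /properP[_ [y yG yA]] : A \proper G.
  by rewrite properEcard sG cG /topsize; lia.
have yAD : y |: A \in D by apply: dD GD _; rewrite subUset sub1set yG sG.
pose P z := (topsize D A <= topsize D (z |: A))%N.
apply: (@exact_one_connected (link D A) P y x) => //.
- exact: down_closed_link.
- exact: exD.
- exact: mem_link.
- exact: mem_link.
- move=> u z nuz; rewrite inE => /and3P[uzD dis AuzD].
  have uA : u \notin A by apply: contraL dis => uA; apply/pred0Pn; exists u; rewrite /= uA !inE eqxx.
  have zA : z \notin A by apply: contraL dis => zA; apply/pred0Pn; exists z; rewrite /= zA !inE eqxx orbT.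
  have e1 : u |: (z |: A) = A :|: [set u; z] by rewrite setUA setUC.
  have e2 : z |: (u |: A) = A :|: [set u; z] by rewrite setUA setUC [[set z; u]]setUC.
  have uz : u \notin z |: A by rewrite !inE negb_or nuz.
  have zu : z \notin u |: A by rewrite !inE negb_or eq_sym nuz.
  have c1 : (#|V| - #|z |: A| < n)%N by rewrite cardsU1 zA.
  have c2 : (#|V| - #|u |: A| < n)%N by rewrite cardsU1 uA.
  have h1 : topsize D (A :|: [set u; z]) = topsize D (z |: A).
    by rewrite -e1; apply: IH; rewrite ?e1.
  have h2 : topsize D (A :|: [set u; z]) = topsize D (u |: A).
    by rewrite -e2; apply: IH; rewrite ?e2.
  have e : topsize D (u |: A) = topsize D (z |: A) by exact: etrans (esym h2) h1.
  by rewrite /P e.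
- rewrite /P -cG; apply: topsize_ge => //.
  by rewrite subUset sub1set yG sG.
Qed.

Lemma topsize_const D A : down_closed D ->
    (forall S, S \in D -> forall k, (k < maxsize (link D S))%N -> exact_at (ones V K) (chains K (link D S)) k) ->
  A \in D -> topsize D A = maxsize D.
Proof.
move=> dD exD; have [n] := ubnP #|A|; elim: n A => // n IH A hn AD.
have [->|[x xA]] := set_0Vmem A; first by rewrite /topsize link_set0 cards0 addn0.
rewrite -(setD1K xA) topsizeU1 ?setD1K //; last by rewrite !inE eqxx.
apply: IH; first by move: hn; rewrite (cardsD1 x A) xA.
by apply: dD AD _; exact: subD1set.
Qed.

End Purity.

(** * Compression *)

Section Compression.
Variable V : finType.
Implicit Types (s : seq V) (G FF GG AA BB : {set {set V}}) (X Y : {set V}) (u w : V).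

(** The splitting replaces the index of [shifted_wrt]: [s1] lists the vertices before [u]. *)
Definition shifted_seq s FF : Prop := forall s1 u s2, s = s1 ++ u :: s2 ->
  forall X w, X \in FF -> w \in X -> w \notin s1 -> u \notin X -> u |: X :\ w \in FF.

Definition compress w u FF X : {set V} :=
  if [&& w \in X, u \notin X & u |: X :\ w \notin FF] then u |: X :\ w else X.

Definition shift_family w u FF : {set {set V}} := [set compress w u FF X | X in FF].

Lemma replaceK w u X : w \in X -> u \notin X -> w |: (u |: X :\ w) :\ u = X.
Proof.
move=> wX uX; rewrite setU1K; first exact: setD1K.
by rewrite !inE (negbTE uX) andbF.
Qed.

Lemma compress_inj w u FF : {in FF &, injective (compress w u FF)}.
Proof.
move=> X Y XF YF; rewrite /compress.
case: ifP => [/and3P[wX uX nX]|_]; case: ifP => [/and3P[wY uY nY]|_] //.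
- by move=> e; rewrite -(replaceK wX uX) e replaceK.
- by move=> e; rewrite e YF in nX.
- by move=> e; rewrite -e XF in nY.
Qed.

Lemma card_shift_family w u FF : #|shift_family w u FF| = #|FF|.
Proof. by rewrite card_in_imset //; exact: compress_inj. Qed.

Lemma card_replace w u X : w \in X -> u \notin X -> #|u |: X :\ w| = #|X|.
Proof.
move=> wX uX; rewrite cardsU1 !inE (negbTE uX) andbF /= add1n.
by rewrite (cardsD1 w X) wX.
Qed.

(** If [Y] stays although it contains [w] and not [u], its shift is already in [BB]; this shift
    meets [X] in a point other than [u] and [w], common to [Y] and the moved [X]. *)
Lemma cross_shift_moved w u AA BB X Y : cross_intersecting AA BB -> X \in AA -> Y \in BB ->
    w \in X -> u \notin X -> compress w u BB Y = Y ->
  (u |: X :\ w) :&: Y != set0.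
Proof.
move=> cr XA YB wX uX; rewrite /compress; case: ifP => [/and3P[wY uY _]|nc _].
  by move=> e; move: uY; rewrite -e !inE eqxx.
have [uY|uY] := boolP (u \in Y); first by apply/set0Pn; exists u; rewrite !inE eqxx.
have [wY|wY] := boolP (w \in Y); last first.
  have /set0Pn[z] := cr X Y XA YB; rewrite inE => /andP[zX zY].
  apply/set0Pn; exists z; rewrite !inE zX zY !andbT.
  by have -> : z != w; rewrite ?orbT //; apply: contraNneq wY => <-.
move: nc; rewrite wY uY /= => /negbFE YB'.
have /set0Pn[z] := cr X _ XA YB'; rewrite !inE => /andP[zX /predU1P[ezu|/andP[nzw zY]]].
  by rewrite -ezu zX in uX.
by apply/set0Pn; exists z; rewrite !inE zX zY nzw orbT.
Qed.

Lemma cross_sym AA BB : cross_intersecting AA BB -> cross_intersecting BB AA.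
Proof. by move=> cr X Y XB YA; rewrite setIC; exact: cr. Qed.

Lemma compress_moved w u FF X : compress w u FF X != X ->
  [/\ w \in X, u \notin X & compress w u FF X = u |: X :\ w].
Proof. by rewrite /compress; case: ifP => [/and3P[]|]; rewrite ?eqxx. Qed.

Lemma cross_shift w u AA BB : cross_intersecting AA BB ->
  cross_intersecting (shift_family w u AA) (shift_family w u BB).
Proof.
move=> cr _ _ /imsetP[X XA ->] /imsetP[Y YB ->].
have [eY|/compress_moved[wY uY eY]] := eqVneq (compress w u BB Y) Y;
  have [eX|/compress_moved[wX uX eX]] := eqVneq (compress w u AA X) X.
- by rewrite eX eY; exact: cr.
- by rewrite eX eY; exact: cross_shift_moved cr XA YB wX uX eY.
- by rewrite eX eY setIC; exact: cross_shift_moved (cross_sym cr) YB XA wY uY eX.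
- by rewrite eX eY; apply/set0Pn; exists u; rewrite !inE eqxx.
Qed.

(** A potential for compression: earlier elements of [s] weigh more, elements outside [s]
    nothing. *)
Definition weight s X := (\sum_(x in X) (size s - index x s))%N.
Definition family_weight s FF := (\sum_(X in FF) weight s X)%N.

Lemma weight_replace s w u X : w \in X -> u \notin X -> (index u s < index w s)%N ->
  (weight s X < weight s (u |: X :\ w))%N.
Proof.
move=> wX uX lt; rewrite /weight (big_setD1 w) //= big_setU1 /=; last by rewrite !inE (negbTE uX) andbF.
by rewrite ltn_add2r ltn_sub2l // (leq_trans lt) ?index_size.
Qed.

Lemma weight_shift s w u FF : (index u s < index w s)%N ->
  (family_weight s FF <= family_weight s (shift_family w u FF))%N.
Proof.
move=> lt; rewrite /family_weight big_imset; last exact: compress_inj.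
apply: leq_sum => X _; rewrite /compress; case: ifP => // /and3P[wX uX _].
exact/ltnW/weight_replace.
Qed.

Lemma weight_shift_lt s w u FF X : (index u s < index w s)%N ->
    X \in FF -> w \in X -> u \notin X -> u |: X :\ w \notin FF ->
  (family_weight s FF < family_weight s (shift_family w u FF))%N.
Proof.
move=> lt XF wX uX nX; rewrite /family_weight big_imset; last exact: compress_inj.
rewrite (bigD1 X) //= [X in (_ < X)%N](bigD1 X) //= -addSn; apply: leq_add.
  by rewrite /compress wX uX nX weight_replace.
apply: leq_sum => Y _; rewrite /compress; case: ifP => // /and3P[wY uY _].
exact/ltnW/weight_replace.
Qed.

Lemma index_lt_split s s1 u s2 w : uniq s -> s = s1 ++ u :: s2 -> w \notin s1 -> w != u ->
  (index u s < index w s)%N.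
Proof.
move=> us es w1 wu; rewrite es in us *; move: us; rewrite cat_uniq => /and3P[_ /hasPn/(_ u) h _].
have u1 : u \notin s1 by apply: h; rewrite mem_head.
rewrite !index_cat (negbTE u1) (negbTE w1) /= eqxx eq_sym (negbTE wu); lia.
Qed.

Lemma shift_family_sub s s1 u s2 w G r FF : s = s1 ++ u :: s2 -> shifted_seq s G -> w \notin s1 ->
  FF \subset faces G r -> shift_family w u FF \subset faces G r.
Proof.
move=> es sG w1 /subsetP sF; apply/subsetP=> _ /imsetP[X XF ->].
rewrite /compress; case: ifP => [/and3P[wX uX _]|_]; last exact: sF.
have := sF X XF; rewrite !inE => /andP[XG cX].
by rewrite card_replace // cX andbT; apply: sG es _ _ XG wX w1 uX.
Qed.

(** Compressing both families at once keeps them cross-intersecting. The bounded total weight can be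
    strictly increased while one of them is not shifted. *)
Lemma exists_shifted s G r AA BB : uniq s -> shifted_seq s G ->
    AA \subset faces G r -> BB \subset faces G r -> cross_intersecting AA BB ->
  exists A' B' : {set {set V}}, [/\ #|A'| = #|AA| /\ #|B'| = #|BB|, A' \subset faces G r /\ B' \subset faces G r,
    cross_intersecting A' B' & shifted_seq s A' /\ shifted_seq s B'].
Proof.
move=> us sG.
have bnd FF : (family_weight s FF <= family_weight s setT)%N.
  rewrite /family_weight [X in (_ <= X)%N](bigID (mem FF)) /=.
  by rewrite [X in (_ <= X + _)%N](eq_bigl (fun X => X \in FF)) ?leq_addr // => X; rewrite inE.
have [n] := ubnP (family_weight s setT + family_weight s setT - (family_weight s AA + family_weight s BB)).
elim: n AA BB => [|n IH] AA BB hn AG BG cr; first by rewrite ltn0 in hn.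
have [[sA sB]|nsh] := Classical_Prop.classic (shifted_seq s AA /\ shifted_seq s BB).
  by exists AA, BB.
have [s1 [u [s2 [w [es w1 lt wlt]]]]] : exists s1 u s2 w, [/\ s = s1 ++ u :: s2, w \notin s1,
    (index u s < index w s)%N & (family_weight s AA + family_weight s BB <
      family_weight s (shift_family w u AA) + family_weight s (shift_family w u BB))%N].
  apply: Classical_Prop.NNPP => no; apply: nsh; split=> s1 u s2 es X w XF wX w1 uX;
    apply: contraT => nX; case: no; exists s1, u, s2, w;
    have wu : w != u by [apply: contraNneq uX => <-];
    have lt := index_lt_split us es w1 wu; split=> //.
    by rewrite -addSn leq_add ?weight_shift // (weight_shift_lt lt XF).
  by rewrite -addnS leq_add ?weight_shift // (weight_shift_lt lt XF).
have bA := bnd (shift_family w u AA); have bB := bnd (shift_family w u BB).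
have hn' : (family_weight s setT + family_weight s setT -
  (family_weight s (shift_family w u AA) + family_weight s (shift_family w u BB)) < n)%N by lia.
have [A' [B' [[cA cB] sub cr' sh]]] := IH _ _ hn' (shift_family_sub es sG w1 AG)
  (shift_family_sub es sG w1 BG) (cross_shift cr).
by exists A', B'; rewrite cA cB !card_shift_family.
Qed.

(** An element of [s] missing from a member is exchanged for an element of the member outside
    [s]. *)
Lemma shifted_top s G FF : uniq s -> shifted_seq s FF -> FF \subset faces G (size s) ->
  FF != set0 -> [set x in s] \in FF.
Proof.
move=> us sF /subsetP FG /set0Pn[X].
have cs : #|[set x in s]| = size s by rewrite cardsE (card_uniqP us).
have [n] := ubnP #|[set x in s] :\: X|; elim: n X => [|n IH] X hn XF; first by rewrite ltn0 in hn.
have /andP[_ /eqP cX] : (X \in G) && (#|X| == size s) by have := FG X XF; rewrite inE.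
have [sX|/subsetPn[u us' uX]] := boolP ([set x in s] \subset X).
  suff -> : [set x in s] = X by [].
  by apply/eqP; rewrite eqEcard sX cX cs leqnn.
have /subsetPn[w wX ws] : ~~ (X \subset [set x in s]).
  apply: contra uX => sX; suff -> : X = [set x in s] by [].
  by apply/eqP; rewrite eqEcard sX cX cs leqnn.
have us2 : u \in s by move: us'; rewrite inE.
have [s1 [s2 def_s]] : exists s1 s2, s = s1 ++ u :: s2.
  by move: us2; clear; case/splitPr=> s1 s2; exists s1, s2.
have w1 : w \notin s1 by apply: contra ws => ws1; rewrite inE def_s mem_cat ws1.
apply: (IH (u |: X :\ w)); last exact: sF def_s X w XF wX w1 uX.
rewrite -ltnS; apply: leq_trans hn; apply: proper_card; apply/properP; split.
  apply/subsetP=> z; rewrite !inE !negb_or => /andP[/andP[_ nz] zs]; rewrite zs andbT.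
  by apply: contra nz => zX; rewrite zX andbT; apply: contraNneq ws => <-; rewrite inE.
by exists u; rewrite !inE ?eqxx // uX us2.
Qed.

End Compression.

(** * Coordinate directions and the theorem *)

Section CoordinateDirections.
Local Open Scope ring_scope.
Variables (V : finType) (K : closedFieldType).
Notation E := {ffun {set V} -> K^o}.
Notation W := {ffun V -> K^o}.
Implicit Types (s : seq V) (FF G : {set {set V}}) (X Y : {set V}) (u w : V) (ths : seq W)
  (Z : nat -> {vspace E}).

Lemma kerpart_dirac u FF :
  kerpart (dirac K u) (coordspace K FF) = coordspace K [set X in FF | u \notin X].
Proof.
apply/vspaceP=> f; rewrite memv_cap memv_ker.
apply/andP/idP=> [[/coordspaceP fF /eqP c0]|/coordspaceP fF].
  apply/coordspaceP=> X; rewrite inE negb_and negbK => /orP[/fF//|uX].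
  have := congr1 (fun g : E => g (X :\ u)) c0; rewrite contr_dirac !inE eqxx /= setD1K // ffunE.
  by move=> /eqP; rewrite mulf_eq0 signr_eq0 => /eqP.
split; first by apply/coordspaceP=> X XF; apply: fF; rewrite inE (negbTE XF).
apply/eqP/ffunP=> X; rewrite contr_dirac ffunE; case: ifP => // uX.
by rewrite fF ?mulr0 // !inE eqxx andbF.
Qed.

Lemma impart_dirac u FF :
  impart (dirac K u) (coordspace K FF) = coordspace K [set X :\ u | X in [set X in FF | u \in X]].
Proof.
apply/eqP; rewrite eqEsubv; apply/andP; split.
  apply/subvP=> _ /memv_imgP[f /coordspaceP fF ->]; apply/coordspaceP=> X nX.
  rewrite contr_dirac; case: ifP => // uX; rewrite fF ?mulr0 //; apply: contra nX => uXF.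
  by apply/imsetP; exists (u |: X); rewrite ?inE ?uXF ?eqxx // setU1K ?uX.
apply/span_subvP=> y /mapP[Y YF ->]; move: YF; rewrite mem_enum => /imsetP[X XF ->].
move: XF; rewrite inE => /andP[XF uX].
have -> : monom K (X :\ u) = sgn K u X *: contr (dirac K u) (monom K X).
  apply/ffunP=> Y'; rewrite [RHS]ffunE contr_dirac !ffunE.
  have [->|nY] := eqVneq Y' (X :\ u).
    by rewrite !inE eqxx /= setD1K // eqxx mulr1 sgn_D1 /GRing.scale /= sgnK.
  case: ifP => uY; first by rewrite scaler0.
  have -> : (u |: Y' == X) = false.
    by apply: contraNF nY => /eqP <-; rewrite setU1K ?uY.
  by rewrite mulr0 scaler0.
by rewrite memvZ // memv_img // memv_monom.
Qed.

Lemma shifted_seq_ker u s FF : uniq (u :: s) -> shifted_seq (u :: s) FF ->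
  shifted_seq s [set X in FF | u \notin X].
Proof.
move=> /= /andP[us _] sF s1 x s2 es X w; rewrite !inE => /andP[XF uX] wX w1 xX.
have nxu : u != x by apply: contraNneq us => ->; rewrite es mem_cat mem_head orbT.
rewrite (negbTE nxu) (negbTE uX) andbF andbT.
apply: (sF (u :: s1) x s2) => //; first by rewrite es.
by rewrite inE negb_or w1 andbT; apply: contraNneq uX => <-.
Qed.

Lemma shifted_seq_im u s FF : uniq (u :: s) -> shifted_seq (u :: s) FF ->
  shifted_seq s [set X :\ u | X in [set X in FF | u \in X]].
Proof.
move=> /= /andP[us _] sF s1 x s2 es Y w /imsetP[X XF ->]; move: XF; rewrite inE => /andP[XF uX].
have nxu : u != x by apply: contraNneq us => ->; rewrite es mem_cat mem_head orbT.
rewrite !inE => /andP[nwu wX] w1; rewrite eq_sym nxu /= => xX.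
apply/imsetP; exists (x |: X :\ w).
  rewrite !inE (negbTE nxu) uX eq_sym nwu /= andbT.
  apply: (sF (u :: s1) x s2) => //; first by rewrite es.
  by rewrite inE negb_or nwu.
apply/setP=> z; rewrite !inE; case: (z =P x) => [->|_] /=; first by rewrite eq_sym nxu.
by rewrite !andbA [_ && (z != u)]andbC.
Qed.

(** For the first vertex [u], shiftedness allows any element of a member without [u] to be exchanged
    for [u]; hence every contraction of the kernel part lies in the image part. Both parts are again
    shifted along [s]. *)
Lemma good_dirac s ths FF : uniq s -> shifted_seq s FF ->
    (forall p, size p = size s -> good ths (res p (map (dirac K) s) (coordspace K FF))) ->
  good (map (dirac K) s ++ ths) (coordspace K FF).
Proof.
elim: s FF => [|u s IH] FF us sF gp; first exact: (gp [::]).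
split.
- move=> eta; rewrite kerpart_dirac impart_dirac; apply/subvP=> _ /memv_imgP[f /coordspaceP fF ->].
  apply/coordspaceP=> X nX; apply: contraNeq nX => /contr_neq0[x xX nf].
  have : x |: X \in [set X in FF | u \notin X] by apply: contraNT nf => /fF ->; rewrite eqxx.
  rewrite !inE negb_or => /and3P[xXF nux uX]; apply/imsetP; exists (u |: X); last by rewrite setU1K.
  rewrite !inE eqxx andbT.
  have := sF [::] u s erefl (x |: X) x xXF; rewrite setU11 setU1K // !inE negb_or nux uX.
  exact.
- rewrite kerpart_dirac; apply: IH; [by case/andP: us|exact: shifted_seq_ker|].
  by move=> p sp; have := gp (false :: p); rewrite /= kerpart_dirac sp; exact.
- rewrite impart_dirac; apply: IH; [by case/andP: us|exact: shifted_seq_im|].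
  by move=> p sp; have := gp (true :: p); rewrite /= impart_dirac sp; exact.
Qed.

Lemma res_nseq_dirac s ths FF :
  res (nseq (size s) false) (map (dirac K) s ++ ths) (coordspace K FF) =
  coordspace K [set X in FF | [disjoint X & [set x in s]]].
Proof.
elim: s FF => [|u s IH] FF /=.
  congr coordspace; apply/setP=> X; rewrite inE.
  by rewrite (_ : [set x in [::]] = set0) -?setI_eq0 ?setI0 ?eqxx ?andbT //; apply/setP=> z; rewrite !inE.
rewrite kerpart_dirac IH; congr coordspace; apply/setP=> X; rewrite !inE -andbA; congr (_ && _).
have -> : [set x in u :: s] = u |: [set x in s] by apply/setP=> z; rewrite !inE.
by rewrite -!setI_eq0 setIUr setU_eq0 !setI_eq0 [[disjoint X & [set u]]]disjoint_sym disjoints1.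
Qed.

Lemma cuts_res n ths Z k : (n <= size ths)%N -> cuts n ths Z k = res (nseq n false) ths (Z k).
Proof. by elim: n ths Z => [|n IH] [|th ths] Z //= hn; rewrite IH. Qed.

Lemma exact_along_eq d ths Z Z' : (forall k, Z k = Z' k) -> exact_along d ths Z -> exact_along d ths Z'.
Proof.
elim: ths d Z Z' => //= th ths IH d Z Z' e [e1 e2]; split; first by move=> j jd; rewrite -!e e1.
by apply: IH e2 => k; rewrite /cut e.
Qed.

Lemma exact_along_mono d d' ths Z : (d' <= d)%N -> exact_along d ths Z -> exact_along d' ths Z.
Proof.
elim: ths d d' Z => //= th ths IH d d' Z ledd [e1 e2]; split.
  by move=> j jd; apply: e1; apply: leq_trans ledd.
by apply: IH e2; lia.
Qed.

Fixpoint dels s G := if s is u :: s' then dels s' (del G u) else G.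

(** The combinatorial form of exactness along coordinate functionals: small faces avoiding the
    deleted vertices [s1] can be joined with the next vertex. *)
Definition extendable s G d := forall s1 u s2, s = s1 ++ u :: s2 -> forall X, X \in G ->
  (#|X| + size s1 < d)%N -> {in s1, forall y, y \notin X} -> u \notin X -> u |: X \in G.

Lemma exact_along_dirac s G d ths : uniq s -> extendable s G d ->
    exact_along (d - size s) ths (chains K (dels s G)) ->
  exact_along d (map (dirac K) s ++ ths) (chains K G).
Proof.
elim: s G d => [|u s IH] G d us xG eT; first by rewrite subn0 in eT.
split.
  move=> j jd; rewrite /chains kerpart_dirac impart_dirac; apply: coordspaceS; apply/subsetP=> X.
  rewrite !inE => /andP[/andP[XG /eqP cX] uX]; apply/imsetP; exists (u |: X); last by rewrite setU1K.
  rewrite !inE eqxx cardsU1 uX cX add1n eqxx !andbT.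
  by apply: (xG [::] u s) => //; rewrite cX addn0.
apply: (@exact_along_eq _ _ (chains K (del G u))).
  move=> k; rewrite /cut /chains kerpart_dirac; congr coordspace; apply/setP=> X.
  by rewrite !inE andbAC.
have e : (d - (size s).+1 = d.-1 - size s)%N by lia.
apply: IH; [by case/andP: us| |by rewrite -e].
move=> s1 x s2 es X; rewrite !inE => /andP[XG uX] hX s1X xX.
have nxu : u != x.
  by apply: contraTneq us => ->; rewrite /= es mem_cat mem_head orbT.
rewrite negb_or nxu uX !andbT; apply: (xG (u :: s1) x s2) => //; first by rewrite es.
  by move: hX => /=; lia.
by move=> y; rewrite inE => /predU1P[->//|/s1X].
Qed.

Lemma dels_acyclic s G d : down_closed G -> acyclic_links K G d ->
  down_closed (dels s G) /\ acyclic_links K (dels s G) (d - size s).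
Proof.
elim: s G d => [|u s IH] G d dG aG /=; first by rewrite subn0.
have -> : (d - (size s).+1 = d.-1 - size s)%N by lia.
apply: IH; first exact: down_closed_del.
exact: acyclic_links_del.
Qed.

Lemma set0_dels s G : set0 \in G -> set0 \in dels s G.
Proof. by elim: s G => //= u s IH G G0; apply: IH; rewrite !inE G0. Qed.

(** A coefficient of the product pairs the disjoint sets [Y] and [X :\: Y], which cannot belong one
    to each family. *)
Lemma perp_coordspace (AA BB : {set {set V}}) : cross_intersecting AA BB ->
  perp (coordspace K AA) (coordspace K BB).
Proof.
have z (A1 B1 : {set {set V}}) l m : cross_intersecting A1 B1 ->
    l \in coordspace K A1 -> m \in coordspace K B1 -> wedge l m = 0.
  move=> cr /coordspaceP lA /coordspaceP mB; apply/ffunP=> X; rewrite !ffunE big1 // => Y _.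
  have [YA|YA] := boolP (Y \in A1); last by rewrite lA // mul0r mulr0.
  have [XB|XB] := boolP (X :\: Y \in B1); last by rewrite mB // !mulr0.
  have := cr _ _ YA XB; rewrite (_ : Y :&: _ = set0) ?eqxx //.
  by apply/setP=> y; rewrite !inE; case: (y \in Y).
by move=> cr l m lA mB; split; [apply: z lA mB|apply: z mB lA; exact: cross_sym].
Qed.

Theorem cross_bound G d r s (AA BB : {set {set V}}) : set0 \in G -> down_closed G ->
    acyclic_links K G d -> (forall X, X \in G -> exists2 H, H \in G & X \subset H /\ #|H| = d) ->
    (0 < r)%N -> (2 * r <= d)%N -> uniq s -> size s = r -> shifted_seq s G ->
    AA \subset faces G r -> BB \subset faces G r -> AA != set0 -> BB != set0 ->
    cross_intersecting AA BB ->
  (#|AA| + #|BB| + #|[set X in faces G r | [disjoint X & [set x in s]]]| <= #|faces G r| + 1)%N.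
Proof.
move=> G0 dG aG pG r0 rd us ss sG AG BG An Bn cr.
have [A' [B' [[cA cB] [A'G B'G] cr' [sA sB]]]] := exists_shifted us sG AG BG cr.
have nA' : A' != set0 by rewrite -card_gt0 cA card_gt0.
have nB' : B' != set0 by rewrite -card_gt0 cB card_gt0.
have A'G2 := A'G; have B'G2 := B'G; rewrite -ss in A'G2 B'G2.
have tA := shifted_top us sA A'G2 nA'; have tB := shifted_top us sB B'G2 nB'.
(* The generic directions must be good for every kernel and image pattern along [s]. With [r.+1] of
   them the whole sequence has length [2 * r + 1], as [setup] requires. *)
pose ps := [seq tval p | p : r.-tuple bool].
have [ths [sz gd gp]] := exists_good_sequence r.+1 (Nil W)
  ([seq res p (map (dirac K) s) (coordspace K A') | p <- ps] ++
   [seq res p (map (dirac K) s) (coordspace K B') | p <- ps]).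
have mem_ps p : size p = size s -> p \in ps.
  by rewrite ss => /eqP sp; apply/mapP; exists (Tuple sp); rewrite ?mem_enum.
pose thS := map (dirac K) s ++ ths.
have gA : good thS (coordspace K A').
  apply: good_dirac => // p /mem_ps pps; apply: gd; rewrite mem_cat.
  by rewrite (map_f (fun p => res p (map (dirac K) s) (coordspace K A')) pps).
have gB : good thS (coordspace K B').
  apply: good_dirac => // p /mem_ps pps; apply: gd; rewrite mem_cat.
  by rewrite (map_f (fun p => res p (map (dirac K) s) (coordspace K B')) pps) orbT.
have [dG' aG'] := dels_acyclic s dG aG.
have eG : exact_along (r + r) thS (chains K G).
  apply: exact_along_dirac => //.
    move=> s1 u s2 es X XG hX s1X uX; have [H HG [XH cH]] := pG X XG.
    have [uH|uH] := boolP (u \in H); first by apply: dG HG _; rewrite subUset sub1set uH.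
    (* [H] has more than [size s1] elements outside [X]; one of them is exchanged for [u]. *)
    have [w wH w1] : exists2 w, w \in H :\: X & w \notin s1.
      have /subsetPn[w wH] : ~~ (H :\: X \subset [set y in s1]).
        apply/negP=> /subset_leq_card; rewrite cardsD (setIidPr XH) cH cardsE.
        move/leq_trans/(_ (card_size s1)); move: hX rd; clear.
        by move: #|X| (size s1) => m n; lia.
      by rewrite inE => ?; exists w.
    move: wH; rewrite inE => /andP[wX wH].
    apply: dG (sG s1 u s2 es H w HG wH w1 uH) _.
    by rewrite setUS // subsetD1 XH.
  (* After [r] deletions the remaining depth [d - r] is at least [r]. *)
  apply: (@exact_along_mono (d - size s)); first by rewrite ss; move: rd; clear; lia.
  have := @exact_along_general_position V K (d - size s) (chains K (dels s G)) ths [::].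
  rewrite subn0; apply=> //; first by apply: graded_chains; rewrite ?set0_dels.
  move=> th c j hc hj; apply: exact_of_acyclic_links dG' aG' _ hj.
  apply: leq_trans hc; apply: subset_leq_card; apply/subsetP=> x.
  by rewrite !inE => /andP[].
have stp : setup thS (chains K G) r r (coordspace K A') (coordspace K B').
  split=> //; first split=> //.
  - by rewrite size_cat size_map ss sz; clear; lia.
  - exact: graded_chains.
  - by split; apply: coordspaceS.
  - exact: perp_coordspace.
(* Each family contains the set of [s], so no member of the other is disjoint from it. *)
have disj0 FF GG : cross_intersecting FF GG -> [set x in s] \in GG ->
    res (nseq r false) thS (coordspace K FF) = 0%VS.
  move=> crFG tG; rewrite -ss res_nseq_dirac (_ : [set X in FF | _] = set0) ?coordspace0 //.
  apply/setP=> X; rewrite !inE; apply/negP=> /andP[XF]; rewrite -setI_eq0 => /eqP dX.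
  by have := crFG X _ XF tG; rewrite dX eqxx.
have := bound_sharp r0 stp (disj0 _ _ cr' tB) (disj0 _ _ (cross_sym cr') tA).
rewrite cuts_res; last by rewrite size_cat size_map ss leq_addr.
have := res_nseq_dirac s ths (faces G r); rewrite ss -/thS /chains => ->.
by rewrite !dim_coordspace cA cB.
Qed.

End CoordinateDirections.

(** * Skeleta and the conclusion *)

Section Main.
Variable V : finType.
Implicit Types (D : {set {set V}}).

Lemma down_closed_skeleton D k : down_closed D -> down_closed (skeleton D k).
Proof.
move=> dD A B; rewrite !inE => /andP[AD cA] BA; rewrite (dD A B AD BA) /=.
exact: leq_trans (subset_leq_card BA) cA.
Qed.

Lemma maxsize_skeleton D k : down_closed D -> D != set0 -> k <= maxsize D ->
  maxsize (skeleton D k) = k.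
Proof.
move=> dD D0 kD; apply/eqP; rewrite eqn_leq; apply/andP; split.
  by apply/bigmax_leqP=> A; rewrite inE => /andP[].
have [A AD cA] := maxsize_attained D0; rewrite -cA in kD.
have [U UA cU] := subset_card kD.
by rewrite -{1}cU; apply: maxsize_ge; rewrite inE cU leqnn andbT; apply: dD AD UA.
Qed.

Lemma faces_skeleton D k r : r <= k -> faces (skeleton D k) r = faces D r.
Proof.
move=> rk; apply/setP=> X; rewrite !inE -andbA; congr (_ && _).
by case: eqP => [->|]; rewrite ?rk ?andbF.
Qed.

End Main.

Theorem theorem1p6 (F : fieldType) (V : finType) (D : {set {set V}}) (d r : nat)
    (v : r.-tuple V) (A B : {set {set V}}) :
  simplicial_complex D ->
  depth_is F D d ->
  (2 <= r)%N -> (2 * r <= d)%N ->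
  A \subset faces D r -> B \subset faces D r ->
  A != set0 -> B != set0 ->
  cross_intersecting A B ->
  uniq v ->
  shifted_wrt D v ->
  (#|A| + #|B| <=
     fvec D r - #|[set X in faces D r | [disjoint X & [set x in v]]]| + 1)%N.
Proof.
move=> [D0 dD] [cm dmax _] r2 rd AD BD An Bn cr uv shv.
have rled : r <= d by move: rd; clear; lia.
have [K eqr] := closed_field_same_rank F.
pose G := skeleton D d.
have dG : down_closed G by exact: down_closed_skeleton.
have mG : maxsize G = d by exact: maxsize_skeleton.
have exG S : S \in G -> forall k, k < maxsize (link G S) ->
    exact_at (ones V K) (chains K (link G S)) k.
  move=> SG k hk; apply: exact_of_red_hom; first exact: down_closed_link.
  exact: red_hom_vanishes_rank eqr (cm S SG k hk).
(* By purity the range of exactness for the link of [S] becomes [d - #|S|]. *)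
have top S : S \in G -> topsize G S = d by move=> SG; rewrite (topsize_const dG exG SG).
have aG : acyclic_links K G d.
  by move=> S SG j hj; apply: exG => //; rewrite -(ltn_add2r #|S|) -/(topsize G S) top.
have fG : faces G r = faces D r by exact: faces_skeleton.
have G0 : set0 \in G.
  by have [X XD] := set0Pn _ D0; rewrite inE cards0 (dD X _ XD) ?sub0set.
have pG X : X \in G -> exists2 H, H \in G & X \subset H /\ #|H| = d.
  by move=> XG; rewrite -(top X XG); exact: topsize_attained.
(* Exchanges preserve sizes, so shiftedness passes to the skeleton. *)
have sG : shifted_seq v G.
  move=> s1 u s2 es X w; rewrite !inE => /andP[XD cX] wX w1 uX.
  rewrite card_replace // cX andbT setUC.
  have hi : size s1 < r by rewrite -(size_tuple v) es size_cat /= addnS ltnS leq_addr.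
  have nthv : tnth v (Ordinal hi) = u.
    by rewrite (tnth_nth u) /= es nth_cat ltnn subnn.
  rewrite -nthv; apply: shv => //; last by rewrite nthv.
  apply/imsetP=> [[j]]; rewrite inE /= leq_eqVlt => /orP[/eqP ej|ltj].
    have -> : j = Ordinal hi by apply: val_inj.
    by rewrite nthv => ewu; rewrite ewu (negbTE uX) in wX.
  rewrite (tnth_nth u) es nth_cat ltj => ew.
  by rewrite ew mem_nth in w1.
have := @cross_bound V K G d r v A B G0 dG aG pG (ltnW r2) rd uv (size_tuple v) sG.
rewrite fG => /(_ AD BD An Bn cr); rewrite /fvec.
have arith a b g f : (a + b + g <= f + 1 -> a + b <= f - g + 1)%N by clear; lia.
exact: arith.
Qed.
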